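(* Let $A\in\mathbb{R}^{n\times n}$ with $\rho(A)<1$, $C\in\mathbb{R}^{m\times n}$, $Q\in\mathbb{S}^n_{++}$ (so that $Q^{-1}$ exists), $R\in\mathbb S^m_{++}$, $\lambda\in(0,1]$, $\Sigma$ the solution of $\Sigma=A\Sigma A^{\top}+Q$, $\Pi=C\Sigma C^{\top}+R$, and $M\in\mathbb S^n_{++}$. For $Y\ge0$ let $\bar X_{ol}(Y)$ denote the unique positive definite solution of $X=g_{\lambda,R+Y^{-1}}(X)$. Then the problem $$\min_{Y}\ \mathrm{tr}(\Pi Y)\quad\text{s.t. } Y\ge0,\ \bar X_{ol}(Y)\le M$$ is equivalent to the semidefinite program $$\min_{S,Y}\ \mathrm{tr}(\Pi Y)\quad\text{s.t. }\Psi(S,Y)\ge0,\ \begin{bmatrix}S&I\\ I&M\end{bmatrix}\ge0,\ Y\ge0,$$ where $$\Psi(S,Y)=\begin{bmatrix} S&\sqrt\lambda SA&\sqrt{1-\lambda}SA&S&0\\ \sqrt\lambda A^{\top}S&S+C^{\top}R^{-1}C&0&0&C^{\top}R^{-1}\\ \sqrt{1-\lambda}A^{\top}S&0&S&0&0\\ S&0&0&Q^{-1}&0\\ 0&R^{-1}C&0&0&Y+R^{-1}\end{bmatrix}.$$ (Equivalent means: $Y$ is feasible for the first problem if and only if there is $S$ such that $(S,Y)$ is feasible for the second, and the objectives coincide.)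
   Context: For $X\ge0$, $W>0$, $\theta\in(0,1]$, $g_{\theta,W}(X)=AXA^{\top}+Q-\theta AXC^{\top}(CXC^{\top}+W)^{-1}CXA^{\top}$. Matrix inequalities are in the positive semidefinite order; $\mathbb S^n_{++}$ denotes symmetric positive definite $n\times n$ matrices. Standing assumptions: $(A,\sqrt Q)$ stabilizable, $(A,C)$ detectable.
   Formalization: For singular Y ≥ 0, where Y^{-1} is undefined, (R+Y^{-1})^{-1} is read as Y(I+RY)^{-1} and g is taken in the form AXA^T+Q-λA(X-(X^{-1}+C^T(R+Y^{-1})^{-1}C)^{-1})A^T, which agrees with the stated formula when Y is invertible. *)

(* Defs.v *)
From HB Require Import structures.
From mathcomp Require Import all_boot all_order all_algebra.
From mathcomp Require Import complex.
Set Implicit Arguments. Unset Strict Implicit. Unset Printing Implicit Defensive.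
Import Order.TTheory GRing.Theory Num.Theory.
Local Open Scope ring_scope.

Section Defs.
Variable R : rcfType.

Definition psd n (X : 'M[R]_n) : Prop :=
  X^T = X /\ forall v : 'cV[R]_n, 0 <= (v^T *m X *m v) 0 0.
Definition pd n (X : 'M[R]_n) : Prop :=
  X^T = X /\ forall v : 'cV[R]_n, v != 0 -> 0 < (v^T *m X *m v) 0 0.
Definition mle n (X Y : 'M[R]_n) : Prop := psd (Y - X).

Definition rho_lt1 n (A : 'M[R]_n) : Prop :=
  forall z : R[i], eigenvalue (map_mx (fun x : R => (x%:C)%C) A) z -> `|z| < 1.

Definition g_map n m (A : 'M[R]_n) (C : 'M[R]_(m, n)) (Q : 'M[R]_n)
    (theta : R) (W : 'M[R]_m) (X : 'M[R]_n) : 'M[R]_n :=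
  A *m X *m A^T + Q
  - theta *: (A *m X *m C^T *m invmx (C *m X *m C^T + W) *m C *m X *m A^T).

(* Same map written with V = W^{-1} (information form), valid also when
   W is "infinite" in some directions (V singular), for X invertible:
   X C^T (C X C^T + W)^{-1} C X = X - (X^{-1} + C^T V C)^{-1}. *)
Definition g_map_inf n m (A : 'M[R]_n) (C : 'M[R]_(m, n)) (Q : 'M[R]_n)
    (theta : R) (V : 'M[R]_m) (X : 'M[R]_n) : 'M[R]_n :=
  A *m X *m A^T + Q
  - theta *: (A *m (X - invmx (invmx X + C^T *m V *m C)) *m A^T).

(* X solves X = g_{lambda, R + Y^{-1}}(X).  When Y is invertible this is the
   paper's formula literally; when Y >= 0 is singular, Y^{-1} is read as
   "infinite" on ker Y, i.e. (R + Y^{-1})^{-1} := Y (I + Rn Y)^{-1}, and the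
   information form of g is used. *)
Definition ol_fixed n m (A : 'M[R]_n) (C : 'M[R]_(m, n)) (Q : 'M[R]_n)
    (Rn : 'M[R]_m) (lam : R) (Y : 'M[R]_m) (X : 'M[R]_n) : Prop :=
  if Y \in unitmx then X = g_map A C Q lam (Rn + invmx Y) X
  else X = g_map_inf A C Q lam (Y *m invmx (1%:M + Rn *m Y)) X.

Definition Xbar_ol n m (A : 'M[R]_n) (C : 'M[R]_(m, n)) (Q : 'M[R]_n)
    (Rn : 'M[R]_m) (lam : R) (Y : 'M[R]_m) (X : 'M[R]_n) : Prop :=
  pd X /\ ol_fixed A C Q Rn lam Y X.

(* "Xbar_ol(Y) <= M" for the (unique) positive definite solution:
   a positive definite solution exists and every such solution is <= M. *)
Definition Xbar_le n m (A : 'M[R]_n) (C : 'M[R]_(m, n)) (Q : 'M[R]_n)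
    (Rn : 'M[R]_m) (lam : R) (Y : 'M[R]_m) (M : 'M[R]_n) : Prop :=
  (exists X, Xbar_ol A C Q Rn lam Y X) /\
  (forall X, Xbar_ol A C Q Rn lam Y X -> mle X M).

Definition Psi n m (A : 'M[R]_n) (C : 'M[R]_(m, n)) (Q : 'M[R]_n)
    (Rn : 'M[R]_m) (lam : R) (S : 'M[R]_n) (Y : 'M[R]_m)
    : 'M[R]_(n + n + n + n + m) :=
  let a := Num.sqrt lam in
  let b := Num.sqrt (1 - lam) in
  let Ri := invmx Rn in
  col_mx (col_mx (col_mx (col_mx
    (row_mx (row_mx (row_mx (row_mx S (a *: (S *m A))) (b *: (S *m A))) S) 0)
    (row_mx (row_mx (row_mx (row_mx (a *: (A^T *m S)) (S + C^T *m Ri *m C)) 0) 0) (C^T *m Ri)))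
    (row_mx (row_mx (row_mx (row_mx (b *: (A^T *m S)) 0) S) 0) 0))
    (row_mx (row_mx (row_mx (row_mx S 0) 0) (invmx Q)) 0))
    (row_mx (row_mx (row_mx (row_mx 0 (Ri *m C)) 0) 0) (Y + Ri)).

Definition SIM n (S M : 'M[R]_n) : 'M[R]_(n + n) := block_mx S 1%:M 1%:M M.

End Defs.

(* Main.v *)
(** Write the open-loop equation in information form: [X] is a solution iff
    [X = f X] where [f X = (1 - lam) A X A^T + lam A (X^-1 + G)^-1 A^T + Q] and
    [G = C^T (Rn + Y^-1)^-1 C].  Completing squares in the last four blocks shows
    that, for [S] positive definite, [Psi S Y >= 0] iff [f (S^-1) <= S^-1], and
    the second linear matrix inequality says [S > 0] and [S^-1 <= M].

    The map [f] is monotone and strictly subhomogeneous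
    ([f (t X) >= t (f X) + (1 - t) Q] for [t <= 1]).  Hence a fixed point [Z] lies
    below every [X] with [f X <= X]: the set of [t <= 1] with [t Z <= X] is stable
    under [t |-> t + (1 - t) eps], so its supremum is [1].  A fixed point exists
    whenever the linear matrix inequalities are feasible: if [S] is a feasible
    point of maximal trace, then [(f (S^-1))^-1 >= S] is feasible too, hence equal
    to [S].

    The base field is an arbitrary real closed field, possibly non-archimedean, so
    suprema and maxima cannot come from completeness.  They exist because the sets
    involved are first-order definable: by quantifier elimination a definable
    subset of the line is constant between finitely many points, so it has a
    supremum, and maxima over closed bounded definable sets follow by choosing
    cluster points one coordinate at a time. *)
Require Import Defs.
From HB Require Import structures.
From Stdlib Require Import Classical_Prop.
From mathcomp Require Import all_boot all_order all_algebra.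
From mathcomp Require Import complex ring lra polyrcf ordered_qelim qe_rcf.
Import Order.TTheory GRing.Theory Num.Theory.
Local Open Scope ring_scope.
Set Implicit Arguments.
Unset Strict Implicit.
Unset Printing Implicit Defensive.

(** * Quadratic forms and the Loewner order *)

Section QuadraticForms.
Variable R : rcfType.

(** Matrix inequalities are tested through these scalars, so that block matrix identities become
    scalar identities within reach of [ring] and [lra]. *)
Definition bl p q (u : 'cV[R]_p) (X : 'M[R]_(p, q)) (v : 'cV[R]_q) : R :=
  (u^T *m X *m v) 0 0.

Lemma blDl p q (u u' : 'cV[R]_p) (X : 'M[R]_(p, q)) (v : 'cV[R]_q) :
  bl (u + u') X v = bl u X v + bl u' X v.
Proof. by rewrite /bl linearD /= !mulmxDl mxE. Qed.

Lemma blDr p q (u : 'cV[R]_p) (X : 'M[R]_(p, q)) (v v' : 'cV[R]_q) :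
  bl u X (v + v') = bl u X v + bl u X v'.
Proof. by rewrite /bl mulmxDr mxE. Qed.

Lemma blDm p q (u : 'cV[R]_p) (X X' : 'M[R]_(p, q)) (v : 'cV[R]_q) :
  bl u (X + X') v = bl u X v + bl u X' v.
Proof. by rewrite /bl mulmxDr mulmxDl mxE. Qed.

Lemma blZl p q a (u : 'cV[R]_p) (X : 'M[R]_(p, q)) (v : 'cV[R]_q) :
  bl (a *: u) X v = a * bl u X v.
Proof. by rewrite /bl linearZ /= -!scalemxAl mxE. Qed.

Lemma blZr p q a (u : 'cV[R]_p) (X : 'M[R]_(p, q)) (v : 'cV[R]_q) :
  bl u X (a *: v) = a * bl u X v.
Proof. by rewrite /bl -!scalemxAr mxE. Qed.

Lemma blZm p q a (u : 'cV[R]_p) (X : 'M[R]_(p, q)) (v : 'cV[R]_q) :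
  bl u (a *: X) v = a * bl u X v.
Proof. by rewrite /bl -!scalemxAr -!scalemxAl mxE. Qed.

Lemma blNl p q (u : 'cV[R]_p) (X : 'M[R]_(p, q)) (v : 'cV[R]_q) :
  bl (- u) X v = - bl u X v.
Proof. by rewrite -scaleN1r blZl mulN1r. Qed.

Lemma blNr p q (u : 'cV[R]_p) (X : 'M[R]_(p, q)) (v : 'cV[R]_q) :
  bl u X (- v) = - bl u X v.
Proof. by rewrite -scaleN1r blZr mulN1r. Qed.

Lemma blNm p q (u : 'cV[R]_p) (X : 'M[R]_(p, q)) (v : 'cV[R]_q) :
  bl u (- X) v = - bl u X v.
Proof. by rewrite -scaleN1r blZm mulN1r. Qed.

Lemma bl0m p q (u : 'cV[R]_p) (v : 'cV[R]_q) : bl u 0 v = 0.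
Proof. by rewrite /bl mulmx0 mul0mx mxE. Qed.

Lemma bl0r p q (u : 'cV[R]_p) (X : 'M[R]_(p, q)) : bl u X 0 = 0.
Proof. by rewrite /bl mulmx0 mxE. Qed.

Lemma bl_tr p q (u : 'cV[R]_p) (X : 'M[R]_(p, q)) (v : 'cV[R]_q) :
  bl u X v = bl v X^T u.
Proof.
rewrite /bl -[LHS](mxE trmx_key (fun i j => (u^T *m X *m v) j i)).
by rewrite -/(trmx _) !trmx_mul trmxK mulmxA.
Qed.

Lemma bl_mull p q r (u : 'cV[R]_p) (B : 'M[R]_(p, q)) (X : 'M[R]_(q, r)) v :
  bl u (B *m X) v = bl (B^T *m u) X v.
Proof. by rewrite /bl trmx_mul trmxK !mulmxA. Qed.

Lemma bl_mulr p q r (u : 'cV[R]_p) (X : 'M[R]_(p, q)) (B : 'M[R]_(q, r)) v :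
  bl u (X *m B) v = bl u X (B *m v).
Proof. by rewrite /bl !mulmxA. Qed.

Lemma bl_sym p (X : 'M[R]_p) u v : X^T = X -> bl u X v = bl v X u.
Proof. by move=> sX; rewrite bl_tr sX. Qed.

Lemma bl_col_row p1 p2 q1 q2 (u1 : 'cV[R]_p1) (u2 : 'cV[R]_p2)
    (v1 : 'cV[R]_q1) (v2 : 'cV[R]_q2) X11 X12 X21 X22 :
  bl (col_mx u1 u2) (block_mx X11 X12 X21 X22) (col_mx v1 v2) =
  bl u1 X11 v1 + bl u1 X12 v2 + bl u2 X21 v1 + bl u2 X22 v2.
Proof.
rewrite /bl tr_col_mx -mulmxA mul_block_col mul_row_col !mulmxDr !mulmxA.
by rewrite !mxE; ring.
Qed.

Lemma bl_col p1 p2 q (u1 : 'cV[R]_p1) (u2 : 'cV[R]_p2) X1 X2 (v : 'cV[R]_q) :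
  bl (col_mx u1 u2) (col_mx X1 X2) v = bl u1 X1 v + bl u2 X2 v.
Proof. by rewrite /bl tr_col_mx mul_row_col mulmxDl mxE. Qed.

Lemma bl_row p q1 q2 (u : 'cV[R]_p) X1 X2 (v1 : 'cV[R]_q1) (v2 : 'cV[R]_q2) :
  bl u (row_mx X1 X2) (col_mx v1 v2) = bl u X1 v1 + bl u X2 v2.
Proof. by rewrite /bl mul_mx_row mul_row_col mxE. Qed.

Lemma bl_delta p q (X : 'M[R]_(p, q)) i j :
  bl (delta_mx i 0) X (delta_mx j 0) = X i j.
Proof. by rewrite /bl trmx_delta -rowE -colE !mxE. Qed.

(** [kermx] is a left kernel, so the argument runs on [X^T]: the transposed rows of its kernel are
    vectors killed by [X]. *)
Lemma unitmx_inj p (X : 'M[R]_p) :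
  (forall v : 'cV_p, X *m v = 0 -> v = 0) -> X \in unitmx.
Proof.
move=> injX; rewrite -unitmx_tr -row_free_unit -kermx_eq0.
have XK : X *m (kermx X^T)^T = 0.
  by apply/trmx_inj; rewrite trmx_mul trmxK trmx0 mulmx_ker.
apply/eqP/trmx_inj; rewrite trmx0; apply/matrixP => i j.
have /injX : X *m col j (kermx X^T)^T = 0 by rewrite colE mulmxA XK mul0mx.
by move/matrixP/(_ i 0); rewrite !mxE.
Qed.

Lemma psd_ge0 p (X : 'M[R]_p) v : psd X -> 0 <= bl v X v.
Proof. by case=> _; apply. Qed.

Lemma pd_gt0 p (X : 'M[R]_p) v : pd X -> v != 0 -> 0 < bl v X v.
Proof. by case=> _; apply. Qed.

Lemma pd_psd p (X : 'M[R]_p) : pd X -> psd X.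
Proof.
move=> pdX; split=> [|v]; first by case: pdX.
have [->|v0] := eqVneq v 0; first by rewrite -/(bl _ _ _) bl0r.
exact/ltW/(pd_gt0 pdX).
Qed.

Lemma pd_unit p (X : 'M[R]_p) : pd X -> X \in unitmx.
Proof.
move=> pdX; apply: unitmx_inj => v Xv0; apply/eqP/negPn/negP => v0.
by have := pd_gt0 pdX v0; rewrite /bl -mulmxA Xv0 mulmx0 mxE ltxx.
Qed.

Lemma psdD p (X Z : 'M[R]_p) : psd X -> psd Z -> psd (X + Z).
Proof.
move=> pX pZ; split=> [|v]; first by rewrite linearD /= pX.1 pZ.1.
by rewrite -/(bl _ _ _) blDm addr_ge0 ?psd_ge0.
Qed.

Lemma pdD p (X Z : 'M[R]_p) : pd X -> psd Z -> pd (X + Z).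
Proof.
move=> pX pZ; split=> [|v v0]; first by rewrite linearD /= pX.1 pZ.1.
by rewrite -/(bl _ _ _) blDm ltr_wpDr ?psd_ge0 ?pd_gt0.
Qed.

Lemma psdZ p a (X : 'M[R]_p) : 0 <= a -> psd X -> psd (a *: X).
Proof.
move=> a0 pX; split=> [|v]; first by rewrite linearZ /= pX.1.
by rewrite -/(bl _ _ _) blZm mulr_ge0 ?psd_ge0.
Qed.

Lemma pdZ p a (X : 'M[R]_p) : 0 < a -> pd X -> pd (a *: X).
Proof.
move=> a0 pX; split=> [|v v0]; first by rewrite linearZ /= pX.1.
by rewrite -/(bl _ _ _) blZm mulr_gt0 ?pd_gt0.
Qed.

Lemma psd_congr p q (B : 'M[R]_(p, q)) X : psd X -> psd (B *m X *m B^T).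
Proof.
move=> pX; split=> [|v]; first by rewrite !trmx_mul trmxK pX.1 mulmxA.
by rewrite -/(bl _ _ _) bl_mulr bl_mull psd_ge0.
Qed.

Lemma sym_inv p (X : 'M[R]_p) : X^T = X -> (invmx X)^T = invmx X.
Proof. by move=> sX; rewrite trmx_inv sX. Qed.

Lemma pd_inv p (X : 'M[R]_p) : pd X -> pd (invmx X).
Proof.
move=> pX; have uX := pd_unit pX; split=> [|v v0]; first exact/sym_inv/pX.1.
rewrite -/(bl _ _ _) -(mulmxK uX (invmx X)) bl_mulr bl_mull.
rewrite trmx_inv pX.1; apply: pd_gt0 => //; apply: contraNneq v0 => w0.
by rewrite -(mulKVmx uX v) w0 mulmx0.
Qed.

Lemma mleP p (X Z : 'M[R]_p) : X^T = X -> Z^T = Z ->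
  mle X Z <-> (forall v, bl v X v <= bl v Z v).
Proof.
move=> sX sZ; split=> [XZ v|XZ].
  by have := psd_ge0 v XZ; rewrite blDm blNm subr_ge0.
split=> [|v]; first by rewrite linearB /= sX sZ.
by rewrite -/(bl _ _ _) blDm blNm subr_ge0.
Qed.

Lemma mle_bl p (X Z : 'M[R]_p) v : mle X Z -> bl v X v <= bl v Z v.
Proof. by move=> /(psd_ge0 v); rewrite blDm blNm subr_ge0. Qed.

Lemma pd_mle p (X Z : 'M[R]_p) : pd X -> mle X Z -> pd Z.
Proof. by move=> pX XZ; rewrite -[Z](subrKC X); apply: pdD. Qed.

Lemma quad_polar p (X : 'M[R]_p) u v : X^T = X ->
  bl (u + v) X (u + v) = bl u X u + 2 * bl u X v + bl v X v.
Proof. by move=> sX; rewrite !(blDl, blDr) (bl_sym v u sX); ring. Qed.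

(** Completing the square: the gap is the form [X] at [w + X^-1 b]. Together with [quad_at_min],
    where the bound is attained, this does the work of Schur complements throughout. *)
Lemma quad_lower_bound p (X : 'M[R]_p) w b : pd X ->
  - bl b (invmx X) b <= bl w X w + 2 * bl w 1%:M b.
Proof.
move=> pX; have uX := pd_unit pX.
have := psd_ge0 (w + invmx X *m b) (pd_psd pX).
rewrite quad_polar ?pX.1 // -!bl_mulr mulmxV //.
have -> : bl (invmx X *m b) 1%:M b = bl b (invmx X) b.
  by rewrite bl_tr trmx1 -bl_mulr mul1mx.
lra.
Qed.

Lemma quad_at_min p (X : 'M[R]_p) b (w := - (invmx X *m b)) : pd X ->
  bl w X w + 2 * bl w 1%:M b = - bl b (invmx X) b.
Proof.
move=> pX; have uX := pd_unit pX; rewrite /w !(blNl, blNr).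
rewrite -!bl_mulr mulmxV //.
have -> : bl (invmx X *m b) 1%:M b = bl b (invmx X) b.
  by rewrite bl_tr trmx1 -bl_mulr mul1mx.
ring.
Qed.

(** [- b^T X^-1 b] is the minimum of a quadratic that increases with [X]; both quadratics are
    compared at the minimiser for [Z]. *)
Lemma mle_inv p (X Z : 'M[R]_p) : pd X -> mle X Z -> mle (invmx Z) (invmx X).
Proof.
move=> pX XZ; have pZ := pd_mle pX XZ.
apply/mleP; [exact/sym_inv/pZ.1 | exact/sym_inv/pX.1 | move=> b].
rewrite -lerN2 -(quad_at_min b pZ).
apply: le_trans (quad_lower_bound (- (invmx Z *m b)) b pX) _.
by apply: lerD => //; apply: mle_bl.
Qed.

(** * Trace and Cauchy-Schwarz bounds *)

Lemma tr_psd_ge0 p (X : 'M[R]_p) : psd X -> 0 <= \tr X.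
Proof. by move=> pX; apply: sumr_ge0 => i _; rewrite -bl_delta psd_ge0. Qed.

Lemma bl_CS p (X : 'M[R]_p) u v : psd X ->
  bl u X v ^+ 2 <= bl u X u * bl v X v.
Proof.
move=> pX; set a := bl u X u; set b := bl u X v; set c := bl v X v.
have Pst s t : 0 <= s ^+ 2 * a + 2 * s * t * b + t ^+ 2 * c.
  have -> : s ^+ 2 * a + 2 * s * t * b + t ^+ 2 * c =
      bl (s *: u + t *: v) X (s *: u + t *: v).
    by rewrite quad_polar ?pX.1 // !(blZl, blZr) -/a -/b -/c; ring.
  exact: psd_ge0.
have a0 : 0 <= a by exact: psd_ge0.
have c0 : 0 <= c by exact: psd_ge0.
have b0 := sqr_ge0 b.
move: a0; rewrite le_eqVlt => /orP[/eqP a0|a0].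
  (* When [a = 0] the form is affine in [s]; at this point it equals [- (c + 2) * b ^+ 2], which
     forces [b = 0]. *)
  have := Pst (- (c + 1)) b; rewrite -a0 mul0r mulr0 add0r.
  have -> : 2 * - (c + 1) * b * b + b ^+ 2 * c = b ^+ 2 * - (c + 2) by ring.
  by rewrite nmulr_lge0 //; lra.
have := Pst (- b) a.
have -> : (- b) ^+ 2 * a + 2 * - b * a * b + a ^+ 2 * c = a * (a * c - b ^+ 2) by ring.
by rewrite pmulr_rge0 // subr_ge0.
Qed.

(** Cauchy-Schwarz against the basis vectors annihilates each coordinate of [X v]. *)
Lemma psd_kernel p (X : 'M[R]_p) v : psd X -> bl v X v = 0 -> X *m v = 0.
Proof.
move=> pX v0; apply/colP => i; rewrite mxE.
have := bl_CS (delta_mx i 0) v pX; rewrite v0 mulr0 => h.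
have : bl (delta_mx i 0) X v = 0 by apply/eqP; rewrite -sqrf_eq0 eq_le h sqr_ge0.
by rewrite /bl trmx_delta -rowE -row_mul !mxE.
Qed.

Lemma psd_tr_eq0 p (X : 'M[R]_p) : psd X -> \tr X = 0 -> X = 0.
Proof.
move=> pX /eqP; rewrite psumr_eq0 => [/allP X0|i _]; last by rewrite -bl_delta psd_ge0.
apply/matrixP => i j; have Xjj : bl (delta_mx j 0) X (delta_mx j 0) = 0.
  by apply/eqP; rewrite bl_delta; apply: X0; rewrite mem_index_enum.
by have := psd_kernel pX Xjj; rewrite -colE => /colP/(_ i); rewrite !mxE.
Qed.

Lemma psd_unit_pd p (X : 'M[R]_p) : psd X -> X \in unitmx -> pd X.
Proof.
move=> pX uX; split=> [|v v0]; first exact: pX.1.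
rewrite lt_neqAle pX.2 andbT eq_sym; apply: contraNneq v0 => /(psd_kernel pX).
by move/(congr1 (mulmx (invmx X))); rewrite mulKmx // mulmx0 => ->.
Qed.

Lemma bl1E p (v : 'cV[R]_p) : bl v 1%:M v = \sum_i v i 0 ^+ 2.
Proof. by rewrite /bl mulmx1 mxE; apply: eq_bigr => i _; rewrite mxE expr2. Qed.

Lemma bl_mulml p q (B : 'M[R]_p) (X : 'M[R]_(p, q)) u v :
  bl (B *m u) X v = bl u (B^T *m X) v.
Proof. by rewrite bl_mull trmxK. Qed.

Lemma psd1 p : psd (1%:M : 'M[R]_p).
Proof.
split=> [|v]; first exact: trmx1.
by rewrite -/(bl _ _ _) bl1E sumr_ge0 // => i _; rewrite sqr_ge0.
Qed.

Lemma bl_delta1 p (v : 'cV[R]_p) i : bl (delta_mx i 0) 1%:M v = v i 0.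
Proof. by rewrite /bl mulmx1 trmx_delta -rowE mxE. Qed.

(** The trace stands in for the largest eigenvalue. Cauchy-Schwarz for [X] gives
    [|X v|^2 <= tr X * v^T X v], and Cauchy-Schwarz for the identity gives
    [(v^T X v)^2 <= |v|^2 |X v|^2]; then one factor [v^T X v] cancels. *)
Lemma psd_le_tr p (X : 'M[R]_p) v : psd X -> bl v X v <= \tr X * bl v 1%:M v.
Proof.
move=> pX; have n1 : 0 <= bl v 1%:M v by exact/psd_ge0/psd1.
have tX := tr_psd_ge0 pX.
have normXv : bl (X *m v) 1%:M (X *m v) <= \tr X * bl v X v.
  rewrite bl1E /mxtrace mulr_suml; apply: ler_sum => i _.
  have := bl_CS (delta_mx i 0) v pX; rewrite bl_delta.
  by rewrite -(bl_delta1 (X *m v)) -bl_mulr mul1mx.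
have := bl_CS v (X *m v) (@psd1 p); rewrite -bl_mulr mul1mx => h.
have := psd_ge0 v pX; rewrite le_eqVlt => /orP[/eqP <-|v0]; first exact: mulr_ge0.
rewrite -(ler_pM2r v0) -expr2 (le_trans h) //.
have -> : \tr X * bl v 1%:M v * bl v X v = bl v 1%:M v * (\tr X * bl v X v) by ring.
exact: ler_wpM2l.
Qed.

(** Each coordinate [v_i] is the [Z]-product of [Z^-1 e_i] with [v], so Cauchy-Schwarz for [Z]
    bounds its square by [(Z^-1)_ii * v^T Z v]; these are summed over [i]. *)
Lemma pd_ge_tr p (Z : 'M[R]_p) v : pd Z -> bl v 1%:M v <= \tr (invmx Z) * bl v Z v.
Proof.
move=> pZ; have uZ := pd_unit pZ.
rewrite bl1E /mxtrace mulr_suml; apply: ler_sum => i _.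
have := bl_CS (invmx Z *m delta_mx i 0) v (pd_psd pZ).
rewrite !bl_mulml trmx_inv pZ.1 mulVmx // -bl_mulr mul1mx.
by rewrite bl_delta1 bl_delta.
Qed.

(** The two trace bounds give an explicit scale and spare a compactness argument on the unit sphere.
    The [1 +] in the denominator keeps it positive when [X] is zero. *)
Lemma mle_scale_pd p (X Z : 'M[R]_p) : psd X -> pd Z ->
  exists2 e, 0 < e & mle (e *: X) Z.
Proof.
move=> pX pZ.
have t0 : 0 <= \tr (invmx Z) by apply/tr_psd_ge0/pd_psd/pd_inv.
have tX := tr_psd_ge0 pX.
have k0 : 0 < 1 + \tr X * \tr (invmx Z) by rewrite ltr_pwDl // mulr_ge0.
exists (1 + \tr X * \tr (invmx Z))^-1; first by rewrite invr_gt0.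
apply/mleP; [by rewrite linearZ /= pX.1 | exact: pZ.1 | move=> v].
rewrite blZm ler_pdivrMl //; apply: le_trans (psd_le_tr v pX) _.
rewrite mulrDl mul1r; apply: ler_wpDl; first exact/psd_ge0/pd_psd.
by rewrite -mulrA; apply: ler_wpM2l => //; apply: pd_ge_tr.
Qed.

Lemma mle_refl p (X : 'M[R]_p) : mle X X.
Proof.
by rewrite /mle subrr; split=> [|v]; rewrite ?trmx0 // -/(bl _ _ _) bl0m.
Qed.

Lemma mle_trans p (X Z W : 'M[R]_p) : mle X Z -> mle Z W -> mle X W.
Proof. by move=> XZ ZW; rewrite /mle -(subrKA Z) addrC; apply: psdD. Qed.

Lemma sym_bl p (X : 'M[R]_p) : (forall u v, bl u X v = bl v X u) -> X^T = X.
Proof. by move=> h; apply/matrixP => i j; rewrite mxE -!bl_delta. Qed.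

(** * Block matrices and the matrix inversion identity *)

Lemma psd_diag p q (X : 'M[R]_p) (Z : 'M[R]_q) : X^T = X -> Z^T = Z ->
  (forall w, 0 <= bl w (block_mx X 0 0 Z) w) <-> psd X /\ psd Z.
Proof.
move=> sX sZ; split=> [h|[pX pZ] w].
  split; split=> // v.
    by have := h (col_mx v 0); rewrite bl_col_row !bl0m bl0r !addr0.
  by have := h (col_mx 0 v); rewrite bl_col_row !bl0m bl0r !add0r.
by rewrite -[w]vsubmxK bl_col_row !bl0m !addr0 addr_ge0 ?psd_ge0.
Qed.

Lemma bl_SIM p (S M : 'M[R]_p) u v : bl (col_mx u v) (SIM S M) (col_mx u v) =
  bl u S u + 2 * bl u 1%:M v + bl v M v.
Proof. by rewrite bl_col_row (bl_sym v u (trmx1 _ _)); ring. Qed.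

Lemma SIM_sym p (S M : 'M[R]_p) : S^T = S -> M^T = M -> (SIM S M)^T = SIM S M.
Proof. by move=> sS sM; rewrite tr_block_mx trmx1 sS sM. Qed.

(** The identity blocks force strictness: if [v^T S v = 0] then [(v, 0)] lies in the kernel of the
    block matrix, whose second row reads [v = 0]. The rest is minimisation over the first
    component. *)
Lemma SIM_psdP p (S M : 'M[R]_p) : pd M ->
  psd (SIM S M) <-> pd S /\ mle (invmx S) M.
Proof.
move=> pM; split=> [pSM|[pS SM]]; last first.
  split=> [|w]; first exact: SIM_sym pS.1 pM.1.
  rewrite -[w]vsubmxK -/(bl _ _ _) bl_SIM.
  have := quad_lower_bound (usubmx w) (dsubmx w) pS; have := mle_bl (dsubmx w) SM; lra.
have sS : S^T = S by have := pSM.1; rewrite tr_block_mx => /eq_block_mx[].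
have pS : pd S.
  split=> // v v0; rewrite -/(bl _ _ _).
  have E : bl (col_mx v 0) (SIM S M) (col_mx v 0) = bl v S v.
    by rewrite bl_SIM !bl0r mulr0 !addr0.
  rewrite lt_neqAle -E psd_ge0 // andbT eq_sym; apply: contraNneq v0 => /(psd_kernel pSM).
  by rewrite mul_block_col !mulmx0 !addr0 mul1mx -col_mx0 => /eq_col_mx[_ ->].
split=> //; apply/mleP => [||v]; [exact/sym_inv | exact: pM.1 |].
have := psd_ge0 (col_mx (- (invmx S *m v)) v) pSM; rewrite bl_SIM quad_at_min //; lra.
Qed.

Lemma invmx_unique p (X Z : 'M[R]_p) : X *m Z = 1%:M -> invmx Z = X.
Proof. by move=> XZ; have [_ uZ] := mulmx1_unit XZ; rewrite -[LHS]mul1mx -XZ mulmxK. Qed.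

(** This links the covariance form of the map to its information form. The candidate inverse is
    checked by multiplication, where replacing [C X C^T] by [N - W] makes the terms cancel. *)
Lemma woodbury n m (C : 'M[R]_(m, n)) X W : pd X -> pd W ->
  X *m C^T *m invmx (C *m X *m C^T + W) *m C *m X =
  X - invmx (invmx X + C^T *m invmx W *m C).
Proof.
move=> pX pW; have uX := pd_unit pX; have uW := pd_unit pW.
set N := _ + W; have uN : N \in unitmx.
  by apply: pd_unit; rewrite /N addrC; apply: pdD => //; apply/psd_congr/pd_psd.
suff -> : invmx (invmx X + C^T *m invmx W *m C) =
    X - X *m C^T *m invmx N *m C *m X by rewrite opprB addrC subrK.
apply: invmx_unique; rewrite mulmxDr !mulmxBl mulmxV // mulmxK //.
have CXC : C *m X *m C^T = N - W by rewrite /N addrK.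
have -> : X *m C^T *m invmx N *m C *m X *m (C^T *m invmx W *m C) =
    X *m C^T *m invmx N *m (C *m X *m C^T) *m invmx W *m C by rewrite !mulmxA.
rewrite CXC mulmxBr mulmxKV // !mulmxBl mulmxK // !mulmxA.
by rewrite subKr subrK.
Qed.

Lemma psd_entry_le p (X : 'M[R]_p) i j : psd X -> `|X i j| <= \tr X.
Proof.
move=> pX; have tX := tr_psd_ge0 pX.
have diag k : X k k <= \tr X.
  rewrite /mxtrace (bigD1 k) //= lerDl sumr_ge0 // => l _.
  by rewrite -bl_delta psd_ge0.
rewrite -(ler_pXn2r (n := 2)) ?nnegrE // real_normK ?num_real //.
have := bl_CS (delta_mx i 0) (delta_mx j 0) pX; rewrite !bl_delta => h.
by apply: le_trans h _; rewrite expr2 ler_pM // -bl_delta psd_ge0.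
Qed.

(** * The Riccati map *)

Section Riccati.
Variables (n : nat) (A Q G : 'M[R]_n) (lam : R).
Hypotheses (pQ : pd Q) (pG : psd G) (lam0 : 0 < lam) (lam1 : lam <= 1).

Definition ric (X : 'M[R]_n) : 'M[R]_n :=
  (1 - lam) *: (A *m X *m A^T) + lam *: (A *m invmx (invmx X + G) *m A^T) + Q.

Lemma bl_ric X u : bl u (ric X) u =
  (1 - lam) * bl (A^T *m u) X (A^T *m u)
  + lam * bl (A^T *m u) (invmx (invmx X + G)) (A^T *m u) + bl u Q u.
Proof.
have bA Z : bl u (A *m Z *m A^T) u = bl (A^T *m u) Z (A^T *m u).
  by rewrite bl_mulr bl_mull.
by rewrite /ric !(blDm, blZm) !bA.
Qed.

Lemma ric_pd X : pd X -> pd (ric X).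
Proof.
move=> pX; rewrite /ric addrC; apply: pdD => //; apply: psdD.
  by apply: psdZ; [rewrite subr_ge0 | apply/psd_congr/pd_psd].
apply: psdZ; first exact: ltW.
by apply/psd_congr/pd_psd/pd_inv/pdD => //; apply: pd_inv.
Qed.

Lemma ric_mono X Z : pd X -> mle X Z -> mle (ric X) (ric Z).
Proof.
move=> pX XZ; have pZ := pd_mle pX XZ.
apply/mleP; [exact: (ric_pd pX).1 | exact: (ric_pd pZ).1 | move=> u].
rewrite !bl_ric lerD2r; apply: lerD; apply: ler_wpM2l.
- by rewrite subr_ge0.
- exact: mle_bl.
- exact: ltW.
- apply/mle_bl/mle_inv; first by apply: pdD => //; apply: pd_inv.
  by rewrite /mle opprD addrACA subrr addr0; apply: mle_inv.
Qed.

(** For [t <= 1] one has [(t X)^-1 + G <= t^-1 (X^-1 + G)]; inverting bounds the nonlinear term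
    below by [t] times its value at [X]. The constant term supplies the surplus [(1 - t) Q]. *)
Lemma ric_subhom X t u : pd X -> 0 < t -> t <= 1 ->
  t * bl u (ric X) u + (1 - t) * bl u Q u <= bl u (ric (t *: X)) u.
Proof.
move=> pX t0 t1; have ptX := pdZ t0 pX; rewrite !bl_ric blZm.
set w := A^T *m u.
have pI := pdD (pd_inv pX) pG; have ptI := pdD (pd_inv ptX) pG.
have uX := pd_unit pX.
suff : t * bl w (invmx (invmx X + G)) w <= bl w (invmx (invmx (t *: X) + G)) w.
  move=> h; have {}h := ler_wpM2l (ltW lam0) h.
  move: h; move: (bl w _ w) (bl w _ w) (bl w _ w) (bl u _ u) => a b c d; lra.
have -> : t * bl w (invmx (invmx X + G)) w = bl w (invmx (t^-1 *: (invmx X + G))) w.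
  by rewrite invmxZ ?unitmxZ ?unitfE ?invr_eq0 ?gt_eqF ?pd_unit // invrK blZm.
apply/mle_bl/mle_inv => //; apply/mleP => [||v].
- exact: ptI.1.
- by rewrite linearZ /= pI.1.
rewrite invmxZ; last exact: pd_unit.
rewrite blDm !blZm blDm mulrDr lerD2l.
rewrite ler_pdivlMl // ler_piMl //; exact: psd_ge0.
Qed.

End Riccati.

End QuadraticForms.

(** * Definable sets over a real closed field *)

Section Definability.
Variable R : rcfType.
Implicit Types (e s : seq R).

(** Division-free ring terms serve twice: they are atoms of first-order formulas, and induction on
    them gives continuity. *)
Definition polyfn (F : seq R -> R) :=
  exists2 t : GRing.term R, GRing.rterm t & forall e, GRing.eval e t = F e.

Lemma polyfn_nth i : polyfn (fun e => e`_i).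
Proof. by exists (GRing.Var R i). Qed.

Lemma polyfn_cst c : polyfn (fun=> c).
Proof. by exists (GRing.Const c). Qed.

Lemma polyfnD F G : polyfn F -> polyfn G -> polyfn (fun e => F e + G e).
Proof.
move=> [t rt tE] [u ru uE]; exists (GRing.Add t u); first by rewrite /= rt.
by move=> e /=; rewrite tE uE.
Qed.

Lemma polyfnM F G : polyfn F -> polyfn G -> polyfn (fun e => F e * G e).
Proof.
move=> [t rt tE] [u ru uE]; exists (GRing.Mul t u); first by rewrite /= rt.
by move=> e /=; rewrite tE uE.
Qed.

Lemma polyfnN F : polyfn F -> polyfn (fun e => - F e).
Proof. by move=> [t rt tE]; exists (GRing.Opp t) => // e /=; rewrite tE. Qed.

Lemma polyfn_ext F G : polyfn F -> F =1 G -> polyfn G.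
Proof. by move=> [t rt tE] FG; exists t => // e; rewrite tE. Qed.

Lemma polyfn_sum (I : Type) (r : seq I) (F : I -> seq R -> R) :
  (forall i, polyfn (F i)) -> polyfn (fun e => \sum_(i <- r) F i e).
Proof.
move=> pF; elim: r => [|i r IH].
  by apply: polyfn_ext (polyfn_cst 0) _ => e; rewrite big_nil.
by apply: polyfn_ext (polyfnD (pF i) IH) _ => e; rewrite big_cons.
Qed.

Definition polymx p q (F : seq R -> 'M[R]_(p, q)) :=
  forall i j, polyfn (fun e => F e i j).

Lemma polymx_cst p q (X : 'M[R]_(p, q)) : polymx (fun=> X).
Proof. by move=> i j; apply: polyfn_cst. Qed.

Lemma polymxD p q (F G : seq R -> 'M[R]_(p, q)) :
  polymx F -> polymx G -> polymx (fun e => F e + G e).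
Proof.
by move=> pF pG i j; apply: polyfn_ext (polyfnD (pF i j) (pG i j)) _ => e; rewrite mxE.
Qed.

Lemma polymxZ p q a (F : seq R -> 'M[R]_(p, q)) :
  polyfn a -> polymx F -> polymx (fun e => a e *: F e).
Proof.
by move=> pa pF i j; apply: polyfn_ext (polyfnM pa (pF i j)) _ => e; rewrite mxE.
Qed.

Lemma polymxM p q r (F : seq R -> 'M[R]_(p, q)) (G : seq R -> 'M[R]_(q, r)) :
  polymx F -> polymx G -> polymx (fun e => F e *m G e).
Proof.
move=> pF pG i j; have h k := polyfnM (pF i k) (pG k j).
by apply: polyfn_ext (polyfn_sum _ h) _ => e; rewrite mxE.
Qed.

Lemma polymxT p q (F : seq R -> 'M[R]_(p, q)) :
  polymx F -> polymx (fun e => (F e)^T).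
Proof. by move=> pF i j; apply: polyfn_ext (pF j i) _ => e; rewrite mxE. Qed.

Lemma polymx_row p q1 q2 (F : seq R -> 'M[R]_(p, q1)) (G : seq R -> 'M[R]_(p, q2)) :
  polymx F -> polymx G -> polymx (fun e => row_mx (F e) (G e)).
Proof.
move=> pF pG i j; case: (split_ordP j) => k ->.
  by apply: polyfn_ext (pF i k) _ => e; rewrite row_mxEl.
by apply: polyfn_ext (pG i k) _ => e; rewrite row_mxEr.
Qed.

Lemma polymx_col p1 p2 q (F : seq R -> 'M[R]_(p1, q)) (G : seq R -> 'M[R]_(p2, q)) :
  polymx F -> polymx G -> polymx (fun e => col_mx (F e) (G e)).
Proof.
move=> pF pG i j; case: (split_ordP i) => k ->.
  by apply: polyfn_ext (pF k j) _ => e; rewrite col_mxEu.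
by apply: polyfn_ext (pG k j) _ => e; rewrite col_mxEd.
Qed.

(** * Continuity of polynomial functions *)

Definition close (d : R) e e' := forall i, `|e'`_i - e`_i| < d.

Definition cont_at (F : seq R -> R) e :=
  forall eps, 0 < eps -> exists2 d, 0 < d & forall e', close d e e' -> `|F e' - F e| < eps.

Lemma cont_atD F G e : cont_at F e -> cont_at G e -> cont_at (fun e => F e + G e) e.
Proof.
move=> cF cG eps eps0; have eps2 : 0 < eps / 2 by lra.
have [d d0 dF] := cF _ eps2; have [d' d'0 dG] := cG _ eps2.
exists (Num.min d d'); first by rewrite lt_min d0.
move=> e' ee'.
have -> : F e' + G e' - (F e + G e) = (F e' - F e) + (G e' - G e) by ring.
apply: le_lt_trans (ler_normD _ _) _; rewrite [eps]splitr; apply: ltrD.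
  by apply: dF => i; apply: lt_le_trans (ee' i) _; rewrite ge_min lexx.
by apply: dG => i; apply: lt_le_trans (ee' i) _; rewrite ge_min lexx orbT.
Qed.

Lemma cont_atM F G e : cont_at F e -> cont_at G e -> cont_at (fun e => F e * G e) e.
Proof.
move=> cF cG eps eps0; pose k := `|F e| + `|G e| + 1.
have k0 : 0 < k by rewrite /k; have := normr_ge0 (F e); have := normr_ge0 (G e); lra.
pose h := Num.min 1 (eps / k).
have h0 : 0 < h by rewrite lt_min ltr01 divr_gt0.
have h1 : h <= 1 by rewrite ge_min lexx.
have hk : h * k <= eps by rewrite -ler_pdivlMr // ge_min lexx orbT.
clearbody h.
have [d d0 dF] := cF _ h0; have [d' d'0 dG] := cG _ h0.
exists (Num.min d d'); first by rewrite lt_min d0.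
move=> e' ee'.
have {}dF : `|F e' - F e| < h.
  by apply: dF => i; apply: lt_le_trans (ee' i) _; rewrite ge_min lexx.
have {}dG : `|G e' - G e| < h.
  by apply: dG => i; apply: lt_le_trans (ee' i) _; rewrite ge_min lexx orbT.
have -> : F e' * G e' - F e * G e =
    (F e' - F e) * G e + (G e' - G e) * F e + (F e' - F e) * (G e' - G e) by ring.
apply: lt_le_trans hk; apply: le_lt_trans (ler_normD _ _) _.
rewrite /k [h * _]mulrDr mulr1; apply: ler_ltD.
  apply: le_trans (ler_normD _ _) _; rewrite !normrM addrC mulrDr.
  by apply: lerD; apply: ler_wpM2r => //; apply: ltW.
rewrite normrM; apply: le_lt_trans (_ : h * `|G e' - G e| < h).
  by apply: ler_wpM2r => //; apply: ltW.
by rewrite gtr_pMr // (lt_le_trans dG).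
Qed.

Lemma cont_at_cst c e : cont_at (fun=> c) e.
Proof. by move=> eps eps0; exists 1 => // e' _; rewrite subrr normr0. Qed.

Lemma cont_at_eval t e : GRing.rterm t -> cont_at (fun e => GRing.eval e t) e.
Proof.
elim: t => //=.
- by move=> i _ eps eps0; exists eps.
- by move=> c _; apply: cont_at_cst.
- by move=> c _; apply: cont_at_cst.
- by move=> t IHt u IHu /andP[/IHt ct /IHu cu]; apply: cont_atD.
- move=> t IHt /IHt ct eps eps0; have [d d0 h] := ct _ eps0.
  by exists d => // e' /h; rewrite -opprD normrN.
- move=> t IHt n /IHt ct; elim: n => [|n IHn]; first exact: cont_at_cst.
  move=> eps eps0; have [d d0 h] := cont_atD ct IHn eps0.
  by exists d => // e' /h; rewrite !mulrS.
- by move=> t IHt u IHu /andP[/IHt ct /IHu cu]; apply: cont_atM.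
- move=> t IHt n /IHt ct; elim: n => [|n IHn]; first exact: cont_at_cst.
  move=> eps eps0; have [d d0 h] := cont_atM ct IHn eps0.
  by exists d => // e' /h; rewrite !exprS.
Qed.

Lemma polyfn_cont F e : polyfn F -> cont_at F e.
Proof.
move=> [t rt tE] eps /(cont_at_eval e rt)[d d0 h].
by exists d => // e' /h; rewrite !tE.
Qed.

Lemma polyfn_closed_ge0 F e : polyfn F ->
  (forall d, 0 < d -> exists2 e', close d e e' & 0 <= F e') -> 0 <= F e.
Proof.
move=> pF cl; rewrite leNgt; apply/negP => Fe.
have Fe0 : 0 < - F e by rewrite oppr_gt0.
have [d d0 h] := polyfn_cont e pF Fe0.
have [e' /h + Fe'] := cl d d0; rewrite ltr_norml => /andP[_]; lra.
Qed.

(** Variables, free or bound, are coordinates of one environment of fixed length [K]; the conditions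
    [i < K] on quantifiers keep that length unchanged. *)
Definition definable K (P : seq R -> Prop) :=
  exists f : ord.formula R, forall e, size e = K -> (ord.holds e f <-> P e).

Lemma definable_ext K P P' : definable K P ->
  (forall e, size e = K -> (P e <-> P' e)) -> definable K P'.
Proof. by move=> [f fP] PP'; exists f => e eK; rewrite fP // PP'. Qed.

Lemma definable_lt K F G : polyfn F -> polyfn G -> definable K (fun e => F e < G e).
Proof. by move=> [t _ tE] [u _ uE]; exists (ord.Lt t u) => e _ /=; rewrite tE uE. Qed.

Lemma definable_le K F G : polyfn F -> polyfn G -> definable K (fun e => F e <= G e).
Proof. by move=> [t _ tE] [u _ uE]; exists (ord.Le t u) => e _ /=; rewrite tE uE. Qed.

Lemma definable_and K P P' :
  definable K P -> definable K P' -> definable K (fun e => P e /\ P' e).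
Proof.
by move=> [f fP] [g gP]; exists (ord.And f g) => e eK /=; rewrite fP // gP.
Qed.

Lemma definable_imp K (P P' : seq R -> Prop) :
  definable K P -> definable K P' -> definable K (fun e => P e -> P' e).
Proof.
by move=> [f fP] [g gP]; exists (ord.Implies f g) => e eK /=; rewrite fP // gP.
Qed.

Lemma definable_ex K i P : (i < K)%N ->
  definable K P -> definable K (fun e => exists x, P (set_nth 0 e i x)).
Proof.
move=> iK [f fP]; exists (ord.Exists i f) => e eK /=.
by split=> -[x hx]; exists x; move: hx; rewrite fP // size_set_nth eK; apply/maxn_idPr.
Qed.

Lemma definable_all K i P : (i < K)%N ->
  definable K P -> definable K (fun e => forall x, P (set_nth 0 e i x)).
Proof.
move=> iK [f fP]; exists (ord.Forall i f) => e eK /=.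
by split=> hx x; move: (hx x); rewrite fP // size_set_nth eK; apply/maxn_idPr.
Qed.

Lemma drop_set_nth (i : nat) e x : (i < size e)%N ->
  drop i (set_nth 0 e i x) = x :: drop i.+1 e.
Proof. by elim: e i => [|y e IH] [|i] //= ie; rewrite ?drop0 ?IH. Qed.

Lemma take_set_nth (i j : nat) e x : (i <= j)%N -> (j < size e)%N ->
  take i (set_nth 0 e j x) = take i e.
Proof. by elim: e i j => [|y e IH] [|i] [|j] //= ij je; rewrite IH. Qed.

(** Quantifies over a whole vector stored from coordinate [a] on. The induction adds one outer
    quantifier, for the last coordinate of the block. *)
Lemma definable_all_block K a k P : (a + k <= K)%N -> definable K P ->
  definable K (fun e => forall s, size s = k -> P (take a e ++ s ++ drop (a + k) e)).
Proof.
move=> + dP; elim: k => [|k IH] akK.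
  apply: definable_ext dP _ => e eK; rewrite addn0; split=> [Pe s|/(_ [::] erefl)].
    by move/size0nil ->; rewrite cat_take_drop.
  by rewrite cat_take_drop.
have akK' : (a + k < K)%N by rewrite -addnS.
apply: definable_ext (definable_all akK' (IH (ltnW akK'))) _ => e eK.
split=> [h s|h x s sk].
  case/lastP: s => // s x; rewrite size_rcons => -[sk]; have := h x s sk.
  by rewrite drop_set_nth ?eK // take_set_nth ?eK ?leq_addr // addnS -cat_rcons.
rewrite drop_set_nth ?eK // take_set_nth ?eK ?leq_addr // -cat_rcons -addnS.
by apply: h; rewrite size_rcons sk.
Qed.

(** Constancy is required only on closed intervals free of breakpoints, so the truth value at a
    breakpoint itself is unconstrained. *)
Definition piecewise (P : R -> Prop) (rs : seq R) := forall x y, x <= y ->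
  (forall r, r \in rs -> ~~ (x <= r <= y)) -> (P x <-> P y).

(** By the intermediate value theorem a sign change needs a root in between, so the roots of [p]
    serve as breakpoints; the zero polynomial needs none. *)
Lemma piecewise_root (p : {poly R}) (P : R -> Prop) :
  (forall x y, Num.sg p.[x] = Num.sg p.[y] -> (P x <-> P y)) ->
  exists rs, piecewise P rs.
Proof.
move=> Psg; have [p0|p0] := eqVneq p 0.
  by exists [::] => x y _ _; apply: Psg; rewrite p0 !horner0.
exists (rootsR p) => x y xy noroot; apply: Psg.
have [//|sxy] := eqVneq (Num.sg p.[x]) (Num.sg p.[y]).
have [] := @polyrcf.poly_ivt _ p x y xy.
  rewrite -sgr_le0 sgrM; move: sxy; case: sgrP => _; case: sgrP => _; rewrite ?eqxx //; lra.
move=> r xry rpr.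
have rE : root p r = (r \in rootsR p).
  by apply: (roots_onP (roots_on_rootsR p0)); rewrite in_itv.
by have := noroot r; move: xry; rewrite -rE rpr in_itv /= => -> /(_ isT).
Qed.

Lemma piecewise2 (P P' Q : R -> Prop) :
  (exists rs, piecewise P rs) -> (exists rs, piecewise P' rs) ->
  (forall x y, (P x <-> P y) -> (P' x <-> P' y) -> (Q x <-> Q y)) ->
  exists rs, piecewise Q rs.
Proof.
move=> [rs h] [rs' h'] QP; exists (rs ++ rs') => x y xy nr.
by apply: QP; [apply: h | apply: h'] => // r rr; apply: nr; rewrite mem_cat rr ?orbT.
Qed.

Lemma rterm_poly (t : GRing.term R) e i : GRing.rterm t ->
  exists p : {poly R}, forall x, GRing.eval (set_nth 0 e i x) t = p.[x].
Proof.
elim: t => //=.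
- move=> j _; have [->|ji] := eqVneq j i.
    by exists 'X => x; rewrite nth_set_nth /= eqxx hornerX.
  by exists (e`_j)%:P => x; rewrite nth_set_nth /= (negbTE ji) hornerC.
- by move=> c _; exists c%:P => x; rewrite hornerC.
- by move=> c _; exists (c%:R)%:P => x; rewrite hornerC.
- move=> t IHt u IHu /andP[/IHt[p pE] /IHu[q qE]]; exists (p + q) => x.
  by rewrite pE qE hornerD.
- by move=> t IHt /IHt[p pE]; exists (- p) => x; rewrite pE hornerN.
- by move=> t IHt n /IHt[p pE]; exists (p *+ n) => x; rewrite pE hornerMn.
- move=> t IHt u IHu /andP[/IHt[p pE] /IHu[q qE]]; exists (p * q) => x.
  by rewrite pE qE hornerM.
- by move=> t IHt n /IHt[p pE]; exists (p ^+ n) => x; rewrite pE horner_exp.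
Qed.

(** Along one coordinate an atom compares two polynomials and depends only on the sign of their
    difference; connectives merge the lists of breakpoints. *)
Lemma qf_piecewise (f : ord.formula R) e i : ord.qf_form f -> ord.rformula f ->
  exists rs, piecewise (fun x => ord.qf_eval (set_nth 0 e i x) f) rs.
Proof.
have atom t u (P : R -> R -> bool) : GRing.rterm t && GRing.rterm u ->
    (forall a b a' b' : R, Num.sg (a - b) = Num.sg (a' - b') -> P a b = P a' b') ->
    exists rs, piecewise (fun x => P (GRing.eval (set_nth 0 e i x) t)
                                    (GRing.eval (set_nth 0 e i x) u)) rs.
  move=> /andP[/(rterm_poly e i)[p pE] /(rterm_poly e i)[q qE]] Psg.
  apply: (piecewise_root (p := p - q)) => x y; rewrite !hornerD !hornerN.
  by rewrite -!pE -!qE => /Psg ->.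
elim: f => //=.
- by move=> b _ _; exists [::].
- move=> t u _ r; apply: (atom t u (fun a b => a == b)) => // a b a' b' h.
  by rewrite -subr_eq0 -sgr_eq0 h sgr_eq0 subr_eq0.
- move=> t u _ r; apply: (atom t u (fun a b => a < b)) => // a b a' b' h.
  by rewrite -subr_lt0 -sgr_lt0 h sgr_lt0 subr_lt0.
- move=> t u _ r; apply: (atom t u (fun a b => a <= b)) => // a b a' b' h.
  by rewrite -subr_le0 -sgr_le0 h sgr_le0 subr_le0.
- move=> f IHf g IHg /andP[/IHf {}IHf /IHg {}IHg] /andP[/IHf {}IHf /IHg {}IHg].
  apply: piecewise2 IHf IHg _ => x y.
  by case: ord.qf_eval; case: ord.qf_eval; case: ord.qf_eval; case: ord.qf_eval => /=; tauto.
- move=> f IHf g IHg /andP[/IHf {}IHf /IHg {}IHg] /andP[/IHf {}IHf /IHg {}IHg].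
  apply: piecewise2 IHf IHg _ => x y.
  by case: ord.qf_eval; case: ord.qf_eval; case: ord.qf_eval; case: ord.qf_eval => /=; tauto.
- move=> f IHf g IHg /andP[/IHf {}IHf /IHg {}IHg] /andP[/IHf {}IHf /IHg {}IHg].
  apply: piecewise2 IHf IHg _ => x y.
  by case: ord.qf_eval; case: ord.qf_eval; case: ord.qf_eval; case: ord.qf_eval => /=; tauto.
- move=> f IHf /IHf {}IHf /IHf {}IHf; apply: (piecewise2 IHf IHf) => x y.
  by case: ord.qf_eval; case: ord.qf_eval => /=; tauto.
Qed.

Lemma definable_piecewise K P i e : definable K P -> size e = K -> (i < K)%N ->
  exists rs, piecewise (fun x => P (set_nth 0 e i x)) rs.
Proof.
move=> [f fP] eK iK.
pose g := ord.quantifier_elim (@wproj R) (ord.to_rform f).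
have /andP[qg rg] : ord.qf_form g && ord.rformula g.
  by apply: ord.quantifier_elim_wf (@wf_QE_wproj R) _ _; apply: ord.to_rform_rformula.
have [rs hrs] := qf_piecewise e i qg rg.
exists rs; have gP x : ord.qf_eval (set_nth 0 e i x) g <-> P (set_nth 0 e i x).
  rewrite -fP; last by rewrite size_set_nth eK; apply/maxn_idPr.
  by split=> /(rcf_satP _ f).
by move=> x y xy nr; rewrite -!gP; apply: hrs.
Qed.

(** * Suprema and minima over definable sets *)

Definition is_ub (P : R -> Prop) b := forall x, P x -> x <= b.

Lemma not_ub (P : R -> Prop) b : ~ is_ub P b -> exists2 y, P y & b < y.
Proof.
move=> nub; apply: NNPP => h; apply: nub => x Px; rewrite leNgt; apply/negP => bx.
by apply: h; exists x.
Qed.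

Lemma above_all (P : R -> Prop) (rs : seq R) a : P a ->
  (forall r, r \in rs -> ~ is_ub P r) ->
  exists2 y, P y & a <= y /\ forall r, r \in rs -> r < y.
Proof.
move=> Pa; elim: rs => [|r rs IH] nub; first by exists a.
have [|y Py [ay rsy]] := IH; first by move=> r' rr; apply: nub; rewrite inE rr orbT.
have [z Pz rz] := not_ub (nub r (mem_head _ _)).
case: (leP y z) => yz.
  exists z => //; split=> [|r']; first exact: le_trans yz.
  by rewrite inE => /orP[/eqP -> //|/rsy h]; apply: lt_le_trans yz.
exists y => //; split=> // r'; rewrite inE => /orP[/eqP ->|/rsy //].
exact: lt_trans yz.
Qed.

Lemma least_ub (P : R -> Prop) (rs : seq R) :
  (exists2 r, r \in rs & is_ub P r) ->
  exists c, [/\ c \in rs, is_ub P c & forall r, r \in rs -> is_ub P r -> c <= r].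
Proof.
elim: rs => [[] //|r rs IH] [r0 r0rs r0ub].
have [/IH[c [crs cub cmin]]|nors] := classic (exists2 r, r \in rs & is_ub P r).
  have [rub|nrub] := classic (is_ub P r); last first.
    exists c; split=> // [|r']; first by rewrite inE crs orbT.
    by rewrite inE => /orP[/eqP -> //|]; apply: cmin.
  case: (leP r c) => rc.
    exists r; split=> // [|r']; first exact: mem_head.
    by rewrite inE => /orP[/eqP -> //|rr /(cmin _ rr)]; apply: le_trans.
  exists c; split=> // [|r']; first by rewrite inE crs orbT.
  by rewrite inE => /orP[/eqP -> _|]; [apply: ltW | apply: cmin].
have r0r : r0 = r.
  by move: r0rs; rewrite inE => /orP[/eqP //|rr]; case: nors; exists r0.
exists r; split=> [||r']; [exact: mem_head | by rewrite -r0r |].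
by rewrite inE => /orP[/eqP -> //|rr ru]; case: nors; exists r'.
Qed.

Lemma piecewise_sup (P : R -> Prop) rs a b : piecewise P rs -> P a -> is_ub P b ->
  exists c, is_ub P c /\ forall b', is_ub P b' -> c <= b'.
Proof.
move=> pw Pa Pb.
have [c [crs cub cmin]] : exists c,
    [/\ c \in rs, is_ub P c & forall r, r \in rs -> is_ub P r -> c <= r].
  (* If no breakpoint bounded [P], some [y] in [P] would exceed them all, and [P] would still hold
     at [b + 1]. *)
  apply: least_ub; apply: NNPP => h.
  have [|y Py [_ rsy]] := @above_all P rs a Pa.
    by move=> r rr ru; apply: h; exists r.
  have := pw y (b + 1); have yb := Pb y Py; case; first lra.
    by move=> r /rsy ry; rewrite negb_and -ltNge ry.
  by move=> /(_ Py) /Pb; lra.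
exists c; split=> // b' b'ub; rewrite leNgt; apply/negP => b'c.
(* Some [y] in [P] exceeds every breakpoint below [c]. No breakpoint separates [y] from the midpoint
   of [b'] and [c], so that midpoint lies in [P], above the bound [b']. *)
have [|y Py [_ rsy]] := @above_all P [seq r <- rs | r < c] a Pa.
  by move=> r; rewrite mem_filter => /andP[rc rr] ru; have := cmin r rr ru; lra.
have := pw y ((b' + c) / 2); have yb := b'ub y Py; case; first lra.
  move=> r rr; case: (ltP r c) => rc; last by rewrite negb_and -!ltNge; apply/orP; right; lra.
  by rewrite negb_and -ltNge rsy // mem_filter rc.
by move=> /(_ Py) /b'ub; lra.
Qed.

Lemma definable_sup K (P : seq R -> Prop) i e a b : definable K P -> size e = K ->
  (i < K)%N -> P (set_nth 0 e i a) -> is_ub (fun x => P (set_nth 0 e i x)) b ->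
  exists c, is_ub (fun x => P (set_nth 0 e i x)) c /\
    forall b', is_ub (fun x => P (set_nth 0 e i x)) b' -> c <= b'.
Proof.
move=> dP eK iK; have [rs pw] := definable_piecewise dP eK iK.
exact: piecewise_sup pw.
Qed.

Lemma take_cat_size N s (s' : seq R) : size s = N -> take N (s ++ s') = s.
Proof. by move=> <-; rewrite take_size_cat. Qed.

(* The limit inferior of [G] along [H -> 0]: [H] accumulates the squared
   deviations of the quantities that have already been made convergent. *)
Lemma cluster_step N K (D : seq R -> Prop) H G B : (N.+1 < K)%N ->
  definable K (fun e => D (take N e)) ->
  polyfn (fun e => H (take N e)) -> polyfn (fun e => G (take N e)) ->
  (forall s, size s = N -> D s -> `|G s| <= B) ->
  (forall t, 0 < t -> exists s, [/\ size s = N, D s & H s < t]) ->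
  exists c, (forall t, 0 < t ->
      exists s, [/\ size s = N, D s & H s + (G s - c) ^+ 2 < t]) /\
    (forall s, size s = N -> D s -> H s <= 0 -> c <= G s).
Proof.
move=> NK dD pH pG GB inf0.
(* [U] collects the eventual lower bounds of [G] as [H -> 0]; its supremum is the limit inferior. *)
pose U a := exists2 t, 0 < t & forall s, size s = N -> D s -> H s < t -> a <= G s.
(* Coordinate [N] carries the candidate bound and coordinate [N.+1] the threshold [t]; the first [N]
   are quantified as a block. *)
have dU : definable K (fun e => U e`_N).
  have := definable_all_block (a := 0) (k := N) (ltnW (ltnW NK))
    (definable_imp dD (definable_imp (definable_lt _ pH (polyfn_nth N.+1))
                                     (definable_le _ (polyfn_nth N) pG))).
  move/(definable_and (definable_lt _ (polyfn_cst 0) (polyfn_nth N.+1))).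
  move/(definable_ex NK) => dU; apply: definable_ext dU _ => e eK.
  have nthE x s : size s = N -> (s ++ drop N (set_nth 0 e N.+1 x))`_N = e`_N /\
      (s ++ drop N (set_nth 0 e N.+1 x))`_N.+1 = x.
    move=> sN; rewrite !nth_cat sN ltnn ltnNge leqnSn /= !nth_drop subnn addn0.
    by rewrite subSnn addn1 !nth_set_nth /= eqxx eqn_leq ltnn andbF.
  split=> -[x].
    rewrite nth_set_nth /= eqxx => -[x0 h]; exists x => // s sN Ds Hs.
    have := h s sN; rewrite take0 /= add0n take_cat_size //.
    by have [-> ->] := nthE x s sN; apply.
  move=> x0 h; exists x; rewrite nth_set_nth /= eqxx; split=> // s sN.
  rewrite take0 /= add0n take_cat_size //; have [-> ->] := nthE x s sN.
  exact: h.
have [s0 [s0N Ds0 Hs0]] := inf0 1 ltr01.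
pose e0 : seq R := nseq K 0.
have UE x : (set_nth 0 e0 N x)`_N = x by rewrite nth_set_nth /= eqxx.
have Uub : is_ub U B.
  move=> a [t t0 h]; have [s [sN Ds Hs]] := inf0 t t0.
  by apply: le_trans (h s sN Ds Hs) _; apply: le_trans (GB s sN Ds); apply: ler_norm.
have [||||c [cub cmin]] := @definable_sup K (fun e => U e`_N) N e0 (- B) B dU.
- exact: size_nseq.
- exact: ltnW.
- rewrite UE; exists 1 => // s sN Ds _.
  by have := GB s sN Ds; rewrite ler_norml => /andP[].
- by move=> x; rewrite UE; apply: Uub.
have {}cub : is_ub U c by move=> a Ua; apply: cub; rewrite UE.
have {}cmin b : is_ub U b -> c <= b by move=> bub; apply: cmin => a; rewrite UE; apply: bub.
exists c; split; last first.
  by move=> s sN Ds Hs; apply: cmin => a [t t0]; apply=> //; apply: le_lt_trans t0.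
move=> t t0.
(* The cap at [1] yields [d ^+ 2 <= d <= t / 2]. *)
pose d := Num.min 1 (t / 2).
have d0 : 0 < d by rewrite lt_min ltr01 /=; lra.
have d1 : d <= 1 by rewrite ge_min lexx.
have dt : d <= t / 2 by rewrite ge_min lexx orbT.
clearbody d.
have [a [t1 t10 ha] ca] : exists2 a, U a & c - d < a.
  apply: NNPP => h; have : c <= c - d; last lra.
  apply: cmin => a Ua; rewrite leNgt; apply/negP => ca.
  by apply: h; exists a.
(* Otherwise [c + d] would belong to [U], which [c] bounds. *)
have [s [sN Ds Hs Gs]] : exists s,
    [/\ size s = N, D s, H s < Num.min t1 (t / 2) & G s < c + d].
  apply: NNPP => h; have : c + d <= c; last lra.
  apply: cub; exists (Num.min t1 (t / 2)); first by rewrite lt_min t10 /=; lra.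
  by move=> s sN Ds Hs; rewrite leNgt; apply/negP => Gs; apply: h; exists s.
move: Hs; rewrite lt_min => /andP[Hs1 Hs2].
have aG := ha s sN Ds Hs1.
exists s; split=> //; rewrite [t]splitr; apply: ltrD => //.
apply: lt_le_trans (_ : d ^+ 2 <= _); last by apply: le_trans dt; rewrite expr2 ger_pMl.
rewrite -real_normK ?num_real // ltr_pXn2r ?nnegrE ?(ltW d0) // ltr_norml.
by apply/andP; split; lra.
Qed.

(** The first cluster step takes [H = 0], so its value [c] is the infimum of [F]; the next ones fix
    the coordinates of a cluster point in turn while [F] stays close to [c]. Closedness puts the
    point in [D], and continuity gives it the value [c]. *)
Lemma definable_argmin N K (D : seq R -> Prop) F B : (N.+1 < K)%N ->
  definable K (fun e => D (take N e)) -> polyfn F ->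
  polyfn (fun e => F (take N e)) ->
  (forall s, size s = N -> D s -> `|F s| <= B) ->
  (forall s i, size s = N -> D s -> `|s`_i| <= B) ->
  (forall s, size s = N -> (forall d, 0 < d ->
      exists s', [/\ size s' = N, D s' & close d s s']) -> D s) ->
  (exists2 s, size s = N & D s) ->
  exists2 s, size s = N & D s /\ forall s', size s' = N -> D s' -> F s <= F s'.
Proof.
move=> NK dD pF pFN FB coordB Dcl [s0 s0N Ds0].
have [|c [cinf cmin]] :=
    cluster_step NK dD (H := fun=> 0) (polyfn_cst 0) pFN FB.
  by move=> t t0; exists s0.
have pfc G v : polyfn G -> polyfn (fun e => (G e - v) ^+ 2).
  by move=> pG; have h := polyfnD pG (polyfn_cst (- v)); apply: polyfn_ext (polyfnM h h) _.
have coordN i : polyfn (fun e => (take N e)`_i).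
  have [iN|Ni] := ltnP i N.
    by apply: polyfn_ext (polyfn_nth i) _ => e; rewrite nth_take.
  apply: polyfn_ext (polyfn_cst 0) _ => e; rewrite nth_default //.
  by rewrite (leq_trans _ Ni) // size_take_min geq_minl.
have cluster k : (k <= N)%N -> exists2 x, size x = k & forall t, 0 < t -> exists s,
    [/\ size s = N, D s & (F s - c) ^+ 2 + \sum_(0 <= i < k) (s`_i - x`_i) ^+ 2 < t].
  elim: k => [_|k IH kN].
    exists [::] => // t /cinf[s [sN Ds]]; rewrite add0r => h; exists s.
    by rewrite big_nil addr0.
  have [x xk xinf] := IH (ltnW kN).
  have [|v [vinf _]] := cluster_step NK dD _ (coordN k) (fun s => coordB s k) xinf.
    apply: polyfnD; first exact: pfc.
    by apply: polyfn_sum => i; apply: pfc.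
  exists (rcons x v) => [|t /vinf[s [sN Ds h]]]; first by rewrite size_rcons xk.
  exists s; split=> //; rewrite big_nat_recr //= addrA nth_rcons xk ltnn eqxx.
  rewrite (eq_big_nat _ _ (F2 := fun i => (s`_i - x`_i) ^+ 2)) // => i /andP[_ ik].
  by rewrite nth_rcons xk ik.
have [x xN xinf] := cluster N (leqnn N).
have near d : 0 < d -> exists s,
    [/\ size s = N, D s, close d x s & (F s - c) ^+ 2 < d].
  (* The bound [d ^+ 2] on the sum of squares makes each coordinate [d]-close; the bound [d]
     controls the deviation of [F]. *)
  move=> d0; pose t := Num.min d (d ^+ 2).
  have t0 : 0 < t by rewrite lt_min d0 exprn_gt0.
  have [s [sN Ds h]] := xinf t t0; exists s.
  have sumge0 : 0 <= \sum_(0 <= i < N) (s`_i - x`_i) ^+ 2.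
    by apply: sumr_ge0 => i _; apply: sqr_ge0.
  split=> // [i|].
    have [iN|Ni] := ltnP i N; last by rewrite !nth_default ?sN ?xN // subrr normr0.
    rewrite -(ltr_pXn2r (n := 2)) ?nnegrE ?(ltW d0) // real_normK ?num_real //.
    apply: lt_le_trans (_ : t <= _); last by rewrite ge_min lexx orbT.
    apply: le_lt_trans h; rewrite -[X in X <= _]add0r; apply: lerD; first exact: sqr_ge0.
    rewrite big_mkord (bigD1 (Ordinal iN)) //= lerDl.
    by apply: sumr_ge0 => j _; apply: sqr_ge0.
  apply: lt_le_trans (_ : t <= _); last by rewrite ge_min lexx.
  by apply: le_lt_trans h; rewrite lerDl.
have Dx : D x.
  by apply: Dcl => // d /near[s [sN Ds xs _]]; exists s.
exists x => //; split=> //.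
have Fx : F x = c.
  apply/eqP; rewrite -subr_eq0 -sqrf_eq0 eq_le sqr_ge0 andbT.
  rewrite leNgt; apply/negP => pos.
  (* Points near [x] have squared deviation below half of that at [x]; passing to the limit
     contradicts its positivity. *)
  suff : 0 <= (F x - c) ^+ 2 / 2 - (F x - c) ^+ 2 by lra.
  apply: (@polyfn_closed_ge0 (fun e => (F x - c) ^+ 2 / 2 - (F e - c) ^+ 2)).
    by apply: polyfnD (polyfn_cst _) _; apply: polyfnN; apply: pfc.
  move=> d d0; have [|s [_ _ xs Fs]] := near (Num.min d ((F x - c) ^+ 2 / 2)).
      by rewrite lt_min d0 /=; lra.
    exists s; first by move=> i; apply: lt_le_trans (xs i) _; rewrite ge_min lexx.
    by rewrite subr_ge0 ltW // (lt_le_trans Fs) // ge_min lexx orbT.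
by move=> s' s'N Ds'; rewrite Fx; apply: cmin.
Qed.

End Definability.

(** * Maximising the trace over a linear matrix inequality *)

Section Lmi.
Variable R : rcfType.
Implicit Types (e s : seq R).

Lemma polyfn_bl p q (u : seq R -> 'cV[R]_p) (X : seq R -> 'M[R]_(p, q)) v :
  polymx u -> polymx X -> polymx v -> polyfn (fun e => bl (u e) (X e) (v e)).
Proof.
by move=> pu pX pv; apply: (polymxM (polymxM (polymxT pu) pX) pv).
Qed.

(** The test vector occupies the [k] coordinates after the first [a]; as [L] reads only those first
    [a], overwriting the block leaves it unchanged. *)
Lemma definable_quad K a k (L : seq R -> 'M[R]_k) : (a + k)%N = K -> polymx L ->
  (forall e, L (take a e) = L e) ->
  definable K (fun e => forall v : 'cV[R]_k, 0 <= bl v (L e) v).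
Proof.
move=> akK pL La.
pose vec e : 'cV[R]_k := \col_i e`_(a + i).
have pvec : polymx vec.
  by move=> i j; apply: polyfn_ext (polyfn_nth R (a + i)) _ => e; rewrite mxE.
have akK' : (a + k <= K)%N by rewrite akK.
have := definable_all_block akK'
  (definable_le K (polyfn_cst 0) (polyfn_bl pvec pL pvec)).
move/definable_ext; apply=> e eK.
have sa : size (take a e) = a by rewrite size_takel // eK -akK leq_addr.
have LE s : L (take a e ++ s) = L e by rewrite -La take_cat_size.
have vecE s i : size s = k -> vec (take a e ++ s ++ drop (a + k) e) i 0 = s`_i.
  by move=> sk; rewrite mxE nth_cat sa ltnNge leq_addr /= addKn nth_cat sk ltn_ord.
split=> [h v|h s sk]; last by rewrite LE; apply: h.
have sk : size (mkseq (fun i => if insub i is Some j then v j 0 else 0) k) = k.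
  exact: size_mkseq.
have := h _ sk; rewrite LE.
set v' := vec _; suff -> : v' = v by [].
apply/colP => i; rewrite vecE // nth_mkseq //.
by case: insubP => [j _ /val_inj ->|] //; rewrite ltn_ord.
Qed.

Definition mxof n e : 'M[R]_n := \matrix_(i, j) e`_(mxvec_index i j).

Lemma polymx_mxof n : polymx (@mxof n).
Proof.
by move=> i j; apply: polyfn_ext (polyfn_nth R (mxvec_index i j)) _ => e; rewrite mxE.
Qed.

Lemma mxof_take n e : mxof n (take (n * n) e) = mxof n e.
Proof. by apply/matrixP => i j; rewrite !mxE nth_take. Qed.

Lemma mxof_onto n (S : 'M[R]_n) : exists2 s, size s = (n * n)%N & mxof n s = S.
Proof.
exists [seq mxvec S 0 i | i <- enum 'I_(n * n)]; first by rewrite size_map size_enum_ord.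
apply/matrixP => i j; rewrite mxE (nth_map (mxvec_index i j)) ?size_enum_ord //.
by rewrite nth_ord_enum mxvecE.
Qed.

Lemma lmi_argmax n k (L : 'M[R]_n -> 'M[R]_k) B :
  polymx (fun e => L (mxof n e)) -> 0 <= B ->
  (forall S : 'M[R]_n, S^T = S -> (forall w, 0 <= bl w (L S) w) ->
     forall i j, `|S i j| <= B) ->
  (exists2 S : 'M[R]_n, S^T = S & forall w, 0 <= bl w (L S) w) ->
  exists S : 'M[R]_n, [/\ S^T = S, forall w, 0 <= bl w (L S) w &
    forall S' : 'M[R]_n, S'^T = S' -> (forall w, 0 <= bl w (L S') w) -> \tr S' <= \tr S].
Proof.
move=> pL B0 LB [S0 sS0 LS0].
(* [N] coordinates hold the matrix, two are spare for the cluster steps, and [k] hold the test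
   vector. *)
pose N := (n * n)%N; pose K := (N.+2 + k)%N.
(* Symmetry becomes one polynomial inequality, hence a definable and closed condition. *)
pose asym (S : 'M[R]_n) := \sum_i \sum_j (S i j - S j i) ^+ 2.
have asymP (S : 'M[R]_n) : asym S <= 0 <-> S^T = S.
  split=> [h|sS]; last first.
    apply: sumr_le0 => i _; apply: sumr_le0 => j _.
    by rewrite -{2}sS mxE subrr expr0n.
  have {h} : asym S == 0.
    by rewrite eq_le h sumr_ge0 // => i _; apply: sumr_ge0 => j _; apply: sqr_ge0.
  rewrite psumr_eq0 => [/allP h|i _]; last by apply: sumr_ge0 => j _; apply: sqr_ge0.
  apply/matrixP => i j; rewrite mxE; have := h i (mem_index_enum _).
  rewrite psumr_eq0 => [/allP/(_ j (mem_index_enum _))|l _]; last exact: sqr_ge0.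
  by rewrite sqrf_eq0 subr_eq0 => /eqP ->.
pose D s := asym (mxof n s) <= 0 /\ forall w, 0 <= bl w (L (mxof n s)) w.
pose F s := - \tr (mxof n s).
have pent i j := @polymx_mxof n i j.
have pasym : polyfn (fun e => asym (mxof n e)).
  apply: polyfn_sum => i; apply: polyfn_sum => j.
  by have h := polyfnD (pent i j) (polyfnN (pent j i)); apply: polyfn_ext (polyfnM h h) _.
have dD : definable K (fun e => D (take N e)).
  have := definable_and (definable_le K pasym (polyfn_cst 0))
    (definable_quad (K := K) (a := N.+2) erefl pL _).
  move=> h; apply: definable_ext (h _) _ => [e|e _]; last by rewrite /D mxof_take.
  by rewrite -mxof_take take_takel ?mxof_take //; rewrite leqW.
have pF : polyfn F.
  by apply: polyfnN; apply: polyfn_sum => i; apply: pent.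
have DB s : D s -> forall i j, `|mxof n s i j| <= B.
  by move=> [/asymP sS LS]; apply: LB.
(* A single bound must cover both the trace, by [B *+ n], and the entries, by [B]. *)
have [||||||s sN [[/asymP sS LS] smin]] :=
    @definable_argmin R N K D F (B *+ n + B) _ dD pF.
- by rewrite /K; apply: ltn_addr.
- by apply: polyfn_ext pF _ => e; rewrite /F mxof_take.
- move=> s sN /DB h; rewrite normrN; apply: le_trans (ler_norm_sum _ _ _) _.
  apply: le_trans (_ : \sum_(i < n) B <= _); first by apply: ler_sum => i _; apply: h.
  by rewrite sumr_const card_ord lerDl.
- move=> s i sN /DB h; apply: le_trans (_ : B <= _); last by rewrite lerDr mulrn_wge0.
  have [iN|Ni] := ltnP i N; last by rewrite nth_default ?sN // normr0.
  have -> : i = Ordinal iN by [].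
  by case/mxvec_indexP: (Ordinal iN) => a b; have := h a b; rewrite mxE.
- move=> s sN cl; split.
    rewrite -oppr_ge0; apply: (polyfn_closed_ge0 (polyfnN pasym)) => d /cl[s' [_ [h _] ss']].
    by exists s' => //; rewrite oppr_ge0.
  move=> w; have pw := polyfn_bl (polymx_cst w) pL (polymx_cst w).
  by apply: (polyfn_closed_ge0 pw) => d /cl[s' [_ [_ h] ss']]; exists s'.
- have [s sN sE] := mxof_onto S0; exists s => //; rewrite /D sE; split=> //.
  exact/asymP.
exists (mxof n s); split=> // S' sS' LS'.
have [s' s'N s'E] := mxof_onto S'; rewrite -lerN2 -s'E.
by apply: smin => //; rewrite /D s'E; split=> //; apply/asymP.
Qed.

End Lmi.

(** * Comparison of fixed points *)

Section Comparison.
Variables (R : rcfType) (n : nat) (A Q G : 'M[R]_n) (lam : R).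
Hypotheses (pQ : pd Q) (pG : psd G) (lam0 : 0 < lam) (lam1 : lam <= 1).

Lemma ric_compare X Z : pd X -> pd Z -> mle (ric A Q G lam X) X ->
  ric A Q G lam Z = Z -> mle Z X.
Proof.
move=> pX pZ fX fZ.
pose T t := t <= 1 /\ forall v, 0 <= bl v (X + t *: - Z) v.
have TP t v : 0 <= bl v (X + t *: - Z) v <-> t * bl v Z v <= bl v X v.
  by rewrite blDm blZm blNm mulrN subr_ge0.
have dT : definable (1 + n) (fun e => T e`_0).
  apply: definable_and.
    by apply: definable_le; [apply: polyfn_nth | apply: polyfn_cst].
  apply: definable_quad erefl _ _ => [|e].
    apply: polymxD; first exact: polymx_cst.
    by apply: polymxZ; [apply: polyfn_nth | apply: polymx_cst].
  by rewrite nth_take.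
have [e1 e10 e1X] := mle_scale_pd (pd_psd pZ) pX.
have [e2 e20 e2Q] := mle_scale_pd (pd_psd pZ) pQ.
have bZ v : 0 <= bl v Z v by exact/psd_ge0/pd_psd.
(* [a] shows that [T] has a positive element; capping [eps] at [1 / 2] keeps [1 - eps] positive. *)
pose a := Num.min 1 e1; pose eps := Num.min (1 / 2) e2.
have a0 : 0 < a by rewrite lt_min ltr01.
have Ta : T a.
  split=> [|v]; first by rewrite ge_min lexx.
  apply/TP; have := mle_bl v e1X; rewrite blZm; apply: le_trans.
  by apply: ler_wpM2r => //; rewrite ge_min lexx orbT.
have eps0 : 0 < eps by rewrite lt_min e20 andbT; lra.
have eps1 : eps < 1 by rewrite gt_min; apply/orP; left; lra.
have epsQ v : eps * bl v Z v <= bl v Q v.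
  have := mle_bl v e2Q; rewrite blZm; apply: le_trans.
  by apply: ler_wpM2r => //; rewrite ge_min lexx orbT.
clearbody a eps.
(* The chain is [X >= f X >= f (t Z) >= t Z + (1 - t) Q >= (t + (1 - t) eps) Z]. *)
have step t : 0 < t -> T t -> T (t + (1 - t) * eps).
  move=> t0 [t1 tX]; split=> [|v]; first by nra.
  apply/TP; have fXv := mle_bl v fX.
  have tZX : mle (t *: Z) X.
    apply/mleP; [by rewrite linearZ /= pZ.1 | exact: pX.1 | move=> w].
    by rewrite blZm; apply/TP.
  have := mle_bl v (ric_mono A pQ pG lam0 lam1 (pdZ t0 pZ) tZX).
  have := ric_subhom A Q pG lam0 v pZ t0 t1; rewrite fZ.
  have := epsQ v; have : 0 <= 1 - t by rewrite subr_ge0.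
  move: fXv; move: (bl v _ v) (bl v _ v) (bl v _ v) (bl v _ v) (bl v _ v) => b1 b2 b3 b4 b5.
  nra.
pose e0 : seq R := nseq (1 + n) 0.
have UE x : (set_nth 0 e0 0 x)`_0 = x by rewrite nth_set_nth.
have [||||c [cub cmin]] := @definable_sup R (1 + n) (fun e => T e`_0) 0 e0 a 1 dT.
- exact: size_nseq.
- by [].
- by rewrite UE.
- by move=> x; rewrite UE => -[].
have {}cub t : T t -> t <= c by move=> Tt; apply: cub; rewrite UE.
have {}cmin b : (forall t, T t -> t <= b) -> c <= b.
  by move=> bub; apply: cmin => t; rewrite UE; apply: bub.
have c1 : 1 <= c.
  have d0 : 0 < 1 - eps by rewrite subr_gt0.
  (* Stability under the step rearranges to this bound; applied to the supremum it gives
     [c (1 - eps) <= c - eps], that is, [1 <= c]. *)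
  have bound t : 0 < t -> T t -> t <= (c - eps) / (1 - eps).
    move=> t0 /(step _ t0)/cub h; rewrite ler_pdivlMr //; lra.
  have : c <= (c - eps) / (1 - eps).
    apply: cmin => t Tt; case: (ltP 0 t) => t0; first exact: bound.
    by apply: le_trans t0 (le_trans (ltW a0) (bound _ a0 Ta)).
  rewrite ler_pdivlMr //; nra.
apply/mleP => [||v]; [exact: pZ.1 | exact: pX.1 |].
rewrite leNgt; apply/negP => h.
have bX : 0 <= bl v X v by exact/psd_ge0/pd_psd.
have z0 : 0 < bl v Z v by exact: le_lt_trans h.
have : c <= bl v X v / bl v Z v.
  by apply: cmin => t [_ /(_ v)/TP]; rewrite ler_pdivlMr.
rewrite ler_pdivlMr //; nra.
Qed.

End Comparison.

(** * The matrix [Psi] and existence of fixed points *)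

Section Psi.
Variables (R : rcfType) (n m : nat) (A : 'M[R]_n) (C : 'M[R]_(m, n)) (Q : 'M[R]_n).
Variables (Rn : 'M[R]_m) (lam : R) (Y : 'M[R]_m).
Hypotheses (pQ : pd Q) (pR : pd Rn) (lam0 : 0 < lam) (lam1 : lam <= 1) (pY : psd Y).

Let V := Y *m invmx (1%:M + Rn *m Y).
Let G := C^T *m V *m C.
Let Ri := invmx Rn.

(** On a kernel vector [v^T Y v = - (Y v)^T Rn (Y v)]; the signs force [Y v = 0], and then
    [v = 0]. *)
Lemma unitmx_1DRY : 1%:M + Rn *m Y \in unitmx.
Proof.
apply: unitmx_inj => v; rewrite mulmxDl mul1mx -mulmxA => /eqP; rewrite addr_eq0 => /eqP vE.
have h : bl v Y v = - bl (Y *m v) Rn (Y *m v).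
  transitivity (bl v Y (- (Rn *m (Y *m v)))); first by rewrite -vE.
  by rewrite blNr -bl_mulr bl_mull pY.1.
suff Yv0 : Y *m v = 0 by rewrite vE Yv0 mulmx0 oppr0.
apply/eqP/negPn/negP => /(pd_gt0 pR); have := psd_ge0 v pY; lra.
Qed.

(** The left side is what eliminating the last block of [Psi] leaves between [C^T] and [C]. *)
Lemma info_mxE : Ri - Ri *m invmx (Y + Ri) *m Ri = V.
Proof.
have uR := pd_unit pR; have uI := unitmx_1DRY.
have -> : Y + Ri = Ri *m (1%:M + Rn *m Y).
  by rewrite mulmxDr mulmx1 mulKmx // addrC.
have -> : invmx (Ri *m (1%:M + Rn *m Y)) = invmx (1%:M + Rn *m Y) *m Rn.
  by apply: invmx_unique; rewrite /Ri mulmxA mulmxK // mulVmx.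
rewrite !mulmxA mulmxK //.
rewrite -{1}(mulmxK uI Ri) -mulmxBl; congr (_ *m _).
by rewrite mulmxDr mulmx1 mulKmx // addrAC subrr add0r.
Qed.

(** Substituting [v = (I + Rn Y) w] turns the form into [w^T Y w + (Y w)^T Rn (Y w)]. *)
Lemma info_mx_psd : psd V.
Proof.
have uI := unitmx_1DRY; have sR := pR.1; have sY := pY.1.
split=> [|v].
  rewrite -info_mxE linearB /= !trmx_mul !(sym_inv sR) !mulmxA sym_inv //.
  by rewrite linearD /= sY sym_inv.
rewrite -/(bl _ _ _) -[v](mulKVmx uI); set w := invmx _ *m v.
rewrite -bl_mulr mulmxKV // bl_mulml linearD /= trmx1 trmx_mul sR sY.
rewrite mulmxDl mul1mx blDm; apply: addr_ge0; first exact: psd_ge0.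
by rewrite bl_mulr bl_mull sY; apply/psd_ge0/pd_psd.
Qed.

Lemma info_gram_psd : psd G.
Proof. by have := psd_congr C^T info_mx_psd; rewrite trmxK. Qed.

(** The information branch is a rearrangement of [ric]. For invertible [Y], [V] is the inverse of
    [Rn + Y^-1], and [woodbury] brings the literal formula to the same form. *)
Lemma ol_fixedE X : pd X -> ol_fixed A C Q Rn lam Y X <-> X = ric A Q G lam X.
Proof.
move=> pX; have infE : g_map_inf A C Q lam V X = ric A Q G lam X.
  rewrite /g_map_inf /ric -/G; move: (invmx (_ + G)) => J.
  rewrite mulmxBr mulmxBl; move: (A *m X *m A^T) (A *m J *m A^T) => P P'.
  by apply/matrixP => i j; rewrite !mxE; ring.
rewrite /ol_fixed -/V infE; case: ifP => // uY.
suff -> : g_map A C Q lam (Rn + invmx Y) X = ric A Q G lam X by [].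
rewrite -infE /g_map /g_map_inf; congr (_ - _ *: _).
have pYi := pd_inv (psd_unit_pd pY uY).
have pW : pd (Rn + invmx Y) by apply: pdD => //; apply: pd_psd.
have -> : V = invmx (Rn + invmx Y).
  symmetry; apply: invmx_unique; rewrite /V.
  have -> : Rn + invmx Y = (1%:M + Rn *m Y) *m invmx Y.
    by rewrite mulmxDl mul1mx mulmxK // addrC.
  by rewrite mulmxA mulmxKV ?unitmx_1DRY // mulmxV.
by rewrite -woodbury // !mulmxA.
Qed.

Section BlPsi.
Variable S : 'M[R]_n.
Let a := Num.sqrt lam.
Let b := Num.sqrt (1 - lam).

Let vec5 (v1 v2 v3 v4 : 'cV[R]_n) (v5 : 'cV[R]_m) :=
  col_mx (col_mx (col_mx (col_mx v1 v2) v3) v4) v5.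

Lemma vec5_onto w : exists v1 v2 v3 v4 v5, w = vec5 v1 v2 v3 v4 v5.
Proof.
do 5!eexists; rewrite /vec5 -[LHS]vsubmxK; congr col_mx.
by do 3!(rewrite -[LHS]vsubmxK; congr col_mx).
Qed.

Lemma bl_Psi (sS : S^T = S) u1 u2 u3 u4 u5 v1 v2 v3 v4 v5 :
  bl (vec5 u1 u2 u3 u4 u5) (Psi A C Q Rn lam S Y) (vec5 v1 v2 v3 v4 v5) =
  bl u1 S v1 + bl u2 S v2 + bl u3 S v3 + bl u4 (invmx Q) v4
  + a * (bl u1 (S *m A) v2 + bl v1 (S *m A) u2)
  + b * (bl u1 (S *m A) v3 + bl v1 (S *m A) u3)
  + (bl u1 S v4 + bl v1 S u4)
  + bl (C *m u2) Ri (C *m v2)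
  + (bl u5 1%:M (Ri *m C *m v2) + bl v5 1%:M (Ri *m C *m u2))
  + (bl u5 Y v5 + bl u5 Ri v5).
Proof.
have sRi : Ri^T = Ri by exact/sym_inv/pR.1.
rewrite /Psi /vec5 !bl_col !bl_row !bl0m !(blDm, blZm).
have E x y : bl x (A^T *m S) y = bl y (S *m A) x.
  by rewrite bl_tr trmx_mul trmxK sS.
have E1 x y : bl x (C^T *m Ri) y = bl y 1%:M (Ri *m C *m x).
  by rewrite bl_tr trmx_mul trmxK sRi -bl_mulr mul1mx.
have E2 x y : bl x (Ri *m C) y = bl x 1%:M (Ri *m C *m y).
  by rewrite -bl_mulr mul1mx.
have E3 x y : bl x (C^T *m Ri *m C) y = bl (C *m x) Ri (C *m y).
  by rewrite bl_mulr bl_mull trmxK.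
rewrite !E E1 E2 E3 (bl_sym u4 v1 sS) -/a -/b -/Ri; ring.
Qed.

Lemma Psi_sym : S^T = S -> (Psi A C Q Rn lam S Y)^T = Psi A C Q Rn lam S Y.
Proof.
move=> sS; apply: sym_bl => u v.
have [u1 [u2 [u3 [u4 [u5 ->]]]]] := vec5_onto u.
have [v1 [v2 [v3 [v4 [v5 ->]]]]] := vec5_onto v.
have sRi : Ri^T = Ri by exact/sym_inv/pR.1.
have sQi : (invmx Q)^T = invmx Q by exact/sym_inv/pQ.1.
rewrite !bl_Psi // (bl_sym v1 u1 sS) (bl_sym v2 u2 sS) (bl_sym v3 u3 sS).
rewrite (bl_sym v4 u4 sQi) (bl_sym _ (C *m u2) sRi) (bl_sym v5 u5 sRi).
by rewrite (bl_sym v5 u5 pY.1); ring.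
Qed.

Lemma bl_G v : bl v G v =
  bl (C *m v) Ri (C *m v) - bl (Ri *m C *m v) (invmx (Y + Ri)) (Ri *m C *m v).
Proof.
have sRi : Ri^T = Ri by exact/sym_inv/pR.1.
rewrite /G bl_mulr bl_mull trmxK -info_mxE blDm blNm; congr (_ - _).
by rewrite bl_mulr bl_mull sRi !mulmxA.
Qed.

(** With [u = S v1], minimising the form over [v2] to [v5] leaves the form of [S^-1 - ric (S^-1)] at
    [u]; [u] is arbitrary because [S] is invertible. *)
Lemma Psi_psd_ric : pd S ->
  psd (Psi A C Q Rn lam S Y) <-> mle (ric A Q G lam (invmx S)) (invmx S).
Proof.
move=> pS; have sS := pS.1; have pSi := pd_inv pS; have uS := pd_unit pS.
have pSG : pd (S + G) by apply: pdD => //; apply: info_gram_psd.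
have pYR : pd (Y + Ri) by rewrite addrC; apply: pdD => //; apply: pd_inv.
have pQi := pd_inv pQ.
have a2 : a ^+ 2 = lam by rewrite sqr_sqrtr // ltW.
have b2 : b ^+ 2 = 1 - lam by rewrite sqr_sqrtr // subr_ge0.
have pf := ric_pd A pQ info_gram_psd lam0 lam1 pSi.
(* The [C^T Ri C] block is split into [G] plus the term that completes the square in [v5]. *)
have E v1 v2 v3 v4 v5 (w := A^T *m (S *m v1)) :
    bl (vec5 v1 v2 v3 v4 v5) (Psi A C Q Rn lam S Y) (vec5 v1 v2 v3 v4 v5) =
    bl (S *m v1) (invmx S) (S *m v1)
    + (bl v2 (S + G) v2 + 2 * bl v2 1%:M (a *: w))
    + (bl v3 S v3 + 2 * bl v3 1%:M (b *: w))
    + (bl v4 (invmx Q) v4 + 2 * bl v4 1%:M (S *m v1))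
    + (bl v5 (Y + Ri) v5 + 2 * bl v5 1%:M (Ri *m C *m v2)
       + bl (Ri *m C *m v2) (invmx (Y + Ri)) (Ri *m C *m v2)).
  rewrite bl_Psi // !blDm bl_G !blZr.
  have -> : bl (S *m v1) (invmx S) (S *m v1) = bl v1 S v1.
    by rewrite -bl_mulr mulVmx // bl_mulml sS mulmx1.
  have SA x : bl v1 (S *m A) x = bl x 1%:M w.
    by rewrite bl_tr trmx_mul sS /w -bl_mulr -bl_mulr !mul1mx.
  have -> : bl v4 1%:M (S *m v1) = bl v1 S v4 by rewrite -bl_mulr mul1mx bl_sym.
  by rewrite !SA; ring.
have E0 v1 (u := S *m v1) (w := A^T *m u) :
    bl u (invmx S) u - bl u (ric A Q G lam (invmx S)) u =
    bl u (invmx S) u - bl (a *: w) (invmx (S + G)) (a *: w)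
    - bl (b *: w) (invmx S) (b *: w) - bl u (invmx (invmx Q)) u.
  rewrite bl_ric !invmxK !(blZl, blZr) -/w !mulrA -!expr2 a2 b2; ring.
split=> [pPsi|fS].
  apply/mleP => [||u]; [exact: pf.1 | exact: pSi.1 |].
  rewrite -subr_ge0 -(mulKVmx uS u) E0.
  set v1 := invmx S *m u; pose w := A^T *m (S *m v1).
  (* Each component is the minimiser of its own quadratic; the one for [v5] depends on [v2]. *)
  pose v2 := - (invmx (S + G) *m (a *: w)).
  have := psd_ge0 (vec5 v1 v2 (- (invmx S *m (b *: w)))
    (- (invmx (invmx Q) *m (S *m v1))) (- (invmx (Y + Ri) *m (Ri *m C *m v2)))) pPsi.
  by rewrite E !quad_at_min // -/w; lra.
split=> [|x]; first exact: Psi_sym.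
have [v1 [v2 [v3 [v4 [v5 ->]]]]] := vec5_onto x; rewrite -/(bl _ _ _) E.
have := mle_bl (S *m v1) fS; rewrite -subr_ge0 E0.
have := quad_lower_bound v2 (a *: (A^T *m (S *m v1))) pSG.
have := quad_lower_bound v3 (b *: (A^T *m (S *m v1))) pS.
have := quad_lower_bound v4 (S *m v1) pQi.
have := quad_lower_bound v5 (Ri *m C *m v2) pYR; lra.
Qed.

(** Testing on [(u, 0, 0, -u, 0)] leaves [u^T Q^-1 u - u^T S u]. This bounds the feasible set. *)
Lemma Psi_psd_le : S^T = S -> psd (Psi A C Q Rn lam S Y) -> mle S (invmx Q).
Proof.
move=> sS pPsi; apply/mleP => [||u]; [by []|exact/sym_inv/pQ.1|].
have := psd_ge0 (vec5 u 0 0 (- u) 0) pPsi.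
by rewrite bl_Psi // !mulmx0 !(blNl, blNr) !bl0r; lra.
Qed.

End BlPsi.
End Psi.

(** * Existence of a fixed point from feasibility *)

Section Existence.
Variables (R : rcfType) (n m : nat) (A : 'M[R]_n) (C : 'M[R]_(m, n)) (Q : 'M[R]_n).
Variables (Rn : 'M[R]_m) (lam : R) (Y : 'M[R]_m) (M : 'M[R]_n).
Hypotheses (pQ : pd Q) (pR : pd Rn) (lam0 : 0 < lam) (lam1 : lam <= 1) (pY : psd Y).
Hypothesis (pM : pd M).

Let V := Y *m invmx (1%:M + Rn *m Y).
Let G := C^T *m V *m C.

Lemma ric_fixed_exists S : psd (Psi A C Q Rn lam S Y) -> psd (SIM S M) ->
  exists2 X, pd X & X = ric A Q G lam X.
Proof.
move=> pPsi pSIM.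
(* Both inequalities are merged into one block diagonal inequality. *)
pose L S := block_mx (Psi A C Q Rn lam S Y) 0 0 (SIM S M).
have LP (T : 'M[R]_n) : T^T = T -> (forall w, 0 <= bl w (L T) w) <->
    psd (Psi A C Q Rn lam T Y) /\ psd (SIM T M).
  move=> sT; apply: psd_diag; first exact: Psi_sym.
  exact: SIM_sym sT pM.1.
have pG : psd G by exact: info_gram_psd.
have sS : S^T = S by have [[]] := (SIM_psdP S pM).1 pSIM.
have trQ := tr_psd_ge0 (pd_psd (pd_inv pQ)).
have pL : polymx (fun e => L (mxof n e)).
  have pS := @polymx_mxof R n.
  have pc := fun p q (X : 'M[R]_(p, q)) => polymx_cst X.
  have pSA (k : R) := polymxZ (polyfn_cst k) (polymxM pS (pc _ _ A)).
  have pAS (k : R) := polymxZ (polyfn_cst k) (polymxM (pc _ _ A^T) pS).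
  have pSC X := polymxD pS (pc _ _ X).
  rewrite /L /Psi /SIM /block_mx.
  by repeat first [exact: pS | exact: pSA | exact: pAS | exact: pSC
    | exact: polymx_cst | apply: polymx_col | apply: polymx_row].
have [|||T [sT /(LP _ sT)[PsiT SIMT] Tmax]] := @lmi_argmax R n _ L (\tr (invmx Q)) pL.
- exact: trQ.
- move=> T sT /(LP _ sT)[PsiT /(SIM_psdP T pM)[pT _]] i j.
  apply: le_trans (psd_entry_le i j (pd_psd pT)) _.
  have := tr_psd_ge0 (Psi_psd_le pQ pR sT PsiT).
  by rewrite linearB /= subr_ge0.
- by exists S => //; apply/LP.
have [pT TM] := (SIM_psdP T pM).1 SIMT.
have fT := (Psi_psd_ric A C pQ pR lam0 lam1 pY pT).1 PsiT; rewrite -/V -/G in fT.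
set X := invmx T in fT TM; have pX : pd X by exact: pd_inv.
have pf : pd (ric A Q G lam X) by exact: ric_pd.
(* Since [f X <= X], monotonicity gives [f (f X) <= f X], and [f X <= X <= M]: so [T'] is feasible
   and dominates [T]. *)
pose T' := invmx (ric A Q G lam X); have pT' : pd T' by exact: pd_inv.
have T'i : invmx T' = ric A Q G lam X by exact: invmxK.
have TT' : mle T T' by rewrite -[T]invmxK; apply: mle_inv.
have trT' : \tr T' <= \tr T.
  apply: Tmax; first exact: pT'.1.
  apply/LP; first exact: pT'.1.
  split; last by apply/SIM_psdP => //; split=> //; rewrite T'i; apply: mle_trans TM.
  apply: (Psi_psd_ric A C pQ pR lam0 lam1 pY pT').2; rewrite T'i.
  exact: (ric_mono A pQ pG lam0 lam1 pf fT).
(* By maximality the positive semidefinite matrix [T' - T] has zero trace, so it vanishes. *)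
exists X => //; rewrite -T'i /X; congr invmx; apply/esym/eqP.
rewrite -subr_eq0; apply/eqP/psd_tr_eq0 => //; apply/eqP; rewrite eq_le.
by rewrite tr_psd_ge0 // linearB /= subr_le0 trT'.
Qed.

End Existence.

Theorem theorem2 (R : rcfType) (n m : nat)
  (A : 'M[R]_n) (C : 'M[R]_(m, n)) (Q : 'M[R]_n) (Rn : 'M[R]_m) (lam : R)
  (Sigma : 'M[R]_n) (Pi : 'M[R]_m) (M : 'M[R]_n) :
  rho_lt1 A -> pd Q -> pd Rn -> 0 < lam -> lam <= 1 ->
  Sigma = A *m Sigma *m A^T + Q ->
  Pi = C *m Sigma *m C^T + Rn ->
  pd M ->
  forall Y : 'M[R]_m,
    ((psd Y /\ Xbar_le A C Q Rn lam Y M) <->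
     (exists S : 'M[R]_n,
        psd (Psi A C Q Rn lam S Y) /\ psd (SIM S M) /\ psd Y))
    /\ \tr (Pi *m Y) = \tr (Pi *m Y).
Proof.
move=> _ pQ pR lam0 lam1 _ _ pM Y; split=> //; split.
  move=> [pY [[X [pX fX]] /(_ X (conj pX fX)) XM]].
  have pS := pd_inv pX; exists (invmx X); split; last first.
    by split=> //; apply/SIM_psdP => //; rewrite invmxK.
  apply: (Psi_psd_ric A C pQ pR lam0 lam1 pY pS).2; rewrite invmxK.
  by rewrite -((ol_fixedE A C Q lam pR pY pX).1 fX); apply: mle_refl.
move=> [S [PsiS [SIMS pY]]]; split=> //; have [pS SM] := (SIM_psdP S pM).1 SIMS.
split=> [|X [pX /(ol_fixedE A C Q lam pR pY pX) fX]].
  have [X pX fX] := ric_fixed_exists pQ pR lam0 lam1 pY pM PsiS SIMS.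
  by exists X; split=> //; apply: (ol_fixedE A C Q lam pR pY pX).2.
(* [S^-1] satisfies [f (S^-1) <= S^-1], so it lies above every fixed point, and [S^-1 <= M]. *)
apply: mle_trans SM; apply: ric_compare (esym fX) => //.
- exact: info_gram_psd.
- exact: pd_inv.
- exact: (Psi_psd_ric A C pQ pR lam0 lam1 pY pS).1 PsiS.
Qed.
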